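(* For every non-negative integer $k$ there are positive constants $\alpha_k,\beta_k,\gamma_k$ such that the following holds. For every $n$-vertex $m$-edge multigraph $G$ with $m\geq 4n$ and every monotone non-homotopic drawing $D$ of $G$: (a) if each pair of edges cross at most $k$ times in $D$, then $D$ has at least $\alpha_k \frac{m^{2+1/k}}{n^{1+1/k}}$ crossings; (b) if each pair of incident edges cross at most $k$ times in $D$, then $D$ has at least $\beta_k \frac{m^{2+1/(k+1)}}{n^{1+1/(k+1)}}$ crossings; (c) if each pair of parallel edges cross at most $k$ times in $D$, then $D$ has at least $\gamma_k \frac{m^{2+1/(k+2)}}{n^{1+1/(k+2)}}$ crossings.
   Context: A multigraph may have parallel edges and loops. A drawing $\phi$ of a multigraph $G$ maps each vertex $v$ to a distinct point $\phi_v\in\mathbb{R}^2$ and each edge $e=vw$ to a continuous curve $\phi_e\colon[0,1]\to\mathbb{R}^2$ with endpoints $\phi_v,\phi_w$ whose interior avoids all vertex images, with finitely many crossings, where a crossing is an unordered pair of distinct pairs $(e,s),(f,t)\in E(G)\times(0,1)$ with $\phi_e(s)=\phi_f(t)$; the number of crossings of the drawing is the number of such unordered pairs. Two parallel edges $e,f$ with end-vertices $v,w$ are homotopic if there is a homotopy in $\mathbb{R}^2\setminus\{\phi_x: x\in V(G)\setminus\{v,w\}\}$ taking $\phi_e$ to $\phi_f$ with endpoints fixed; the drawing is non-homotopic if no two parallel edges are homotopic. The drawing is monotone if every edge is an x-monotone curve (meets every vertical line in at most one point). Two edges are incident if they share at least one end-vertex. *)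

(* Defs.v *)
From HB Require Import structures.
From mathcomp Require Import all_boot all_order all_algebra. 
From mathcomp Require Import finmap.
From mathcomp Require Import all_classical all_reals all_analysis.

Set Implicit Arguments.
Unset Strict Implicit.
Unset Printing Implicit Defensive.

Import Order.TTheory GRing.Theory Num.Theory.
Import numFieldNormedType.Exports.

Local Open Scope classical_set_scope.
Local Open Scope ring_scope.

(* An edge is given by its set of end-vertices: a singleton for a loop, a pair
   otherwise. *)
Record multigraph := Multigraph {
  vertex : finType;
  edge : finType;
  ends : edge -> {set vertex};
  ends_card : forall e, (0 < #|ends e| <= 2)%N
}.

Definition parallel (G : multigraph) (e f : edge G) : Prop := ends e = ends f.

Definition incident (G : multigraph) (e f : edge G) : Prop :=
  exists v : vertex G, v \in ends e /\ v \in ends f.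

(* A crossing is the unordered pair {(e, s), (f, t)}, represented as a set. The
   case e = f, s <> t is a self-crossing. *)
Definition crossings (R : realType) (E : finType) (phi : E -> R -> R * R) :
    set (set (E * R)) :=
  [set X | exists p q : E * R,
    [/\ p <> q, 0 < p.2 < 1, 0 < q.2 < 1,
        phi p.1 p.2 = phi q.1 q.2 & X = [set p; q]]].

(* Curves are functions on all of R of which only the restriction to [0, 1]
   matters; an edge may be traversed in either direction. *)
Record drawing (R : realType) (G : multigraph) := Drawing {
  vpoint : vertex G -> R * R;
  ecurve : edge G -> R -> R * R;
  vpoint_inj : injective vpoint;
  ecurve_continuous : forall e, {within `[0, 1], continuous (ecurve e)};
  ecurve_ends : forall e, exists v w : vertex G,
    [/\ ends e = [set v; w]%SET, ecurve e 0 = vpoint v & ecurve e 1 = vpoint w];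
  ecurve_avoid : forall e (t : R) (v : vertex G),
    0 < t < 1 -> ecurve e t <> vpoint v;
  crossings_finite : finite_set (crossings ecurve)
}.

Section DrawingNotions.
Variables (R : realType) (G : multigraph) (D : drawing R G).

Definition num_crossings : nat := #|` fset_set (crossings (ecurve D))|.

Definition num_crossings_between (e f : edge G) : nat :=
  #|` fset_set [set X | crossings (ecurve D) X /\
                        exists s t : R, X = [set (e, s); (f, t)]]|.

(* c and d are homotopic with endpoints fixed, within the plane minus the images
   of the vertices outside U. *)
Definition path_homotopic (U : {set vertex G}) (c d : R -> R * R) : Prop :=
  exists H : R * R -> R * R,
    [/\ {within `[0, 1] `*` `[0, 1], continuous H},
        forall t, 0 <= t <= 1 -> H (0, t) = c t /\ H (1, t) = d t,
        forall u, 0 <= u <= 1 -> H (u, 0) = c 0 /\ H (u, 1) = c 1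
      & forall u t x, 0 <= u <= 1 -> 0 <= t <= 1 -> x \notin U ->
          H (u, t) <> vpoint D x].

(* Edges are undirected, so the curve of f may have to be reversed before it is
   compared with that of e. *)
Definition homotopic_edges (e f : edge G) : Prop :=
  path_homotopic (ends e) (ecurve D e) (ecurve D f) \/
  path_homotopic (ends e) (ecurve D e) (fun t => ecurve D f (1 - t)).

Definition non_homotopic : Prop :=
  forall e f : edge G, e <> f -> parallel e f -> ~ homotopic_edges e f.

Definition monotone_drawing : Prop :=
  forall (e : edge G) (s t : R), 0 <= s <= 1 -> 0 <= t <= 1 ->
    (ecurve D e s).1 = (ecurve D e t).1 -> ecurve D e s = ecurve D e t.

End DrawingNotions.

(* Main.v *)
Require Import Defs.
From mathcomp Require Import all_boot all_order all_algebra.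
From mathcomp Require Import finmap zify lra.
From mathcomp Require Import all_classical all_reals all_analysis.
Import Order.TTheory GRing.Theory Num.Theory.
Import numFieldNormedType.Exports.

Set Implicit Arguments.
Unset Strict Implicit.
Unset Printing Implicit Defensive.

(** The sampling works because two unsampled edges that meet no sampled edge and see a vertex on the
    same side can be followed away from it together. A sampled edge can come between them only by
    starting at a vertex that they pass on opposite sides, and this vertex is an end of a sampled
    edge. The sides taken at the visible ends of that kind are [O(1)] bits; edges with equal bits
    see the same vertices. In such a class the member reaching farthest left and the one reaching
    farthest right together see every vertex that matters, up to three, and so a set of [s] vertices
    suffices for the local bound.

    The exponent drops from [D] to [D-1] because an edge is counted once for every vertex that it
    sees: edges seeing about [x] vertices number [O(n x^D / x)], and these bounds add up
    geometrically over dyadic [x].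

    Visibility is cheap on average: an edge sees a vertex only if all edges nearer to it on that
    side are unsampled, so a geometric series gives at most [2q] viewers per vertex. The bound
    [m <= 4X] is needed because [q] must also exceed a constant, and yet [qm] has to be [O(X)]. *)

(** By monotonicity every edge is the graph of a continuous function over an
    interval, and two parallel edges passing on the same side of every vertex
    between their ends are homotopic. So a set of edges living on [n] vertices is
    a set of sign words, and contracting the last vertex into its predecessor
    shows by induction that there are at most [(3n)^D] of them, with [D = k+1],
    [k+2] and [k+3] under the hypotheses of (a), (b) and (c); when nothing
    crosses the bound is [3n], so that [m >= 4n] forces at least [m/4] crossings.

    Let [X] be the number of crossings and sample every edge with probability
    [1/q], where [q] is of order [X/m]. A constant proportion of the edges crosses
    no sampled edge, sees (vertically, without a sampled edge in between)
    [O(1)] ends of sampled edges and [O(nq/m)] vertices: an edge is hidden from a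
    vertex as soon as one of the edges between them is sampled. Such an edge is
    determined, up to [O(1)] choices, by one vertex that it sees and by its
    position relative to the vertices that it sees, so the local bound [(3s)^D]
    applied with [s = O(nq/m)] and summed over the vertices yields
    [m <= C n (nq/m)^(D-1)], which is the theorem. *)

(** * Words of edges *)

(* A word records, from right to left, how an edge meets a list of vertices: 2 at
   its ends, 1 or 3 where it passes below or above, 0 outside its range. [valid0],
   [valid1] and [valid2] expect 2, 1 and 0 further ends. *)
Fixpoint valid2 (w : seq nat) : bool :=
  if w is a :: t then (a == 0) && valid2 t else true.
Fixpoint valid1 (w : seq nat) : bool :=
  if w is a :: t then
    ((a == 2) && valid2 t) || (((a == 1) || (a == 3)) && valid1 t)
  else false.
Fixpoint valid0 (w : seq nat) : bool :=
  if w is a :: t then ((a == 0) && valid0 t) || ((a == 2) && valid1 t)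
  else false.

Definition cmp (b : bool) (x y : nat) :=
  [&& 0 < x, 0 < y & if b then x < y else y < x].

(* [u] and [v] are strictly ordered at [j] positions, alternately, the first time
   with [u] below [v] iff [b]. *)
Fixpoint altn (b : bool) (j : nat) (u v : seq nat) {struct u} : bool :=
  if j is i.+1 then
    match u, v with
    | x :: u', y :: v' => (cmp b x y && altn (~~ b) i u' v') || altn b j u' v'
    | _, _ => false
    end
  else true.

Definition altfree (j : nat) (G : seq (seq nat)) :=
  forall u v, u \in G -> v \in G -> u != v -> forall b, ~~ altn b j u v.

Lemma altn0 b u v : altn b 0 u v.
Proof. by case: u. Qed.

Lemma valid2_eq u v : valid2 u -> valid2 v -> size u = size v -> u = v.
Proof.
elim: u v => [|a u IH] [|c v] //= /andP[/eqP -> hu] /andP[/eqP -> hv] [e].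
by rewrite (IH v).
Qed.

(** Until one of the words ends, both letters are positive, so a first difference would already be a
    strict comparison. *)
Lemma valid1_eq u v : valid1 u -> valid1 v -> size u = size v ->
  (forall b, ~~ altn b 1 u v) -> u = v.
Proof.
elim: u v => [|a u IH] [|c v] //= hu hv [e] h.
have eac : a = c.
  have /norP[ht _] := h true; have /norP[hf _] := h false.
  by move: ht hf hu hv; rewrite /cmp !altn0 !andbT /=; lia.
subst c; congr (_ :: _).
case/orP: hu => /andP[ha hu].
  case/orP: hv => /andP[hc hv]; last by move: ha hc; lia.
  exact: valid2_eq.
case/orP: hv => /andP[hc hv]; first by move: ha hc; lia.
by apply: IH => // b; have /norP[] := h b.
Qed.

Lemma altn_cons b j x y u v : altn b j u v -> altn b j (x :: u) (y :: v).
Proof. by case: j => //= j ->; rewrite orbT. Qed.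

Lemma altn_consN b j x y u v :
  ~~ cmp b x y -> altn b j (x :: u) (y :: v) -> altn b j u v.
Proof. by case: j => [|j] /=; [case: u | move/negbTE => ->]. Qed.

Lemma cmp_true x y : 0 < x -> x < y -> cmp true x y.
Proof. by rewrite /cmp => x0 xy; rewrite x0 xy (ltn_trans x0 xy). Qed.

Lemma cmp_false x y : 0 < y -> y < x -> cmp false x y.
Proof. by rewrite /cmp => y0 yx; rewrite y0 yx (ltn_trans y0 yx). Qed.

(** Base of the recursion on the number of alternations: with a common right end and no strict
    comparison, nothing is left to distinguish two words. *)
Lemma words_head2 (G : seq (seq nat)) n : uniq G ->
  (forall w, w \in G -> [/\ valid0 w, size w = n & head 0 w = 2]) ->
  altfree 1 G -> size G <= 1.
Proof.
case: G => [|u [|v G]] //= /andP[+ _] hG hf; rewrite inE negb_or => /andP[neq _].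
have [|hu su hhu] := hG u; first by rewrite inE eqxx.
have [|hv sv hhv] := hG v; first by rewrite !inE eqxx orbT.
have hfb b : ~~ altn b 1 u v by apply: hf; rewrite // !inE eqxx ?orbT.
case/eqP: neq; move: u v hhu hhv hu hv su sv hfb {hG hf}.
case=> [|a u] [|c v] //= -> -> /= hu hv <- [e] hf; congr (_ :: _).
by apply: valid1_eq => // b; have /norP[] := hf b.
Qed.

Definition strip (p : seq nat) (G : seq (seq nat)) : seq (seq nat) :=
  [seq drop (size p) w | w <- G & take (size p) w == p].

Lemma mem_strip p G t : (t \in strip p G) = (p ++ t \in G).
Proof.
apply/mapP/idP => [[w]|h].
  by rewrite mem_filter => /andP[/eqP e hw] ->; rewrite -{1}e cat_take_drop.
exists (p ++ t); last by rewrite drop_size_cat.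
by rewrite mem_filter take_size_cat // eqxx.
Qed.

Lemma strip_uniq p G : uniq G -> uniq (strip p G).
Proof.
move=> uG; rewrite map_inj_in_uniq ?filter_uniq // => u v.
rewrite !mem_filter => /andP[/eqP eu _] /andP[/eqP ev _] e.
by rewrite -(cat_take_drop (size p) u) eu e -{1}ev cat_take_drop.
Qed.

Lemma size_strip p G : size (strip p G) = count (fun w => take (size p) w == p) G.
Proof. by rewrite size_map size_filter. Qed.

(* Reading a word from its right end, the contraction of the last vertex into
   its predecessor identifies the three words 2 1 t, 0 2 t and 2 3 t; two words
   that are both hit twice alternate once less. *)
Lemma words_bound n j (G : seq (seq nat)) : uniq G ->
  (forall w, w \in G -> valid0 w && (size w == n)) ->
  altfree j.+2 G -> size G <= (3 * n) ^ j.+1.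
Proof.
elim: n j G => [|n IH] j G uG hG fG.
  case: G hG {uG fG} => //= w G /(_ w); rewrite inE eqxx => /(_ isT).
  by case: w => //= a t; rewrite andbF.
pose GN := strip [:: 0] G; pose GD := strip [:: 2; 1] G.
pose GU := strip [:: 2; 3] G; pose GS := strip [:: 2; 2] G.
pose NM t := (2 :: t) \in GN.
(* One representative of each merged class enters [Phi], with [GN] preferred to [GU] and [GU] to
   [GD]; [A1] and [A2] hold the surplus. *)
pose D1 := [seq t <- GD | ~~ (NM t || (t \in GU))].
pose A1 := [seq t <- GD | NM t || (t \in GU)].
pose U1 := [seq t <- GU | ~~ NM t].
pose A2 := [seq t <- GU | NM t].
have vN t : t \in GN -> valid0 t /\ size t = n.
  by rewrite mem_strip => /hG /= /andP[]; rewrite orbF => ? /eqP[].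
have vD t : t \in GD -> valid1 t /\ (size t).+1 = n.
  by rewrite mem_strip => /hG /= /andP[? /eqP[]].
have vU t : t \in GU -> valid1 t /\ (size t).+1 = n.
  by rewrite mem_strip => /hG /= /andP[? /eqP[]].
have vS t : t \in GS -> valid2 t /\ (size t).+1 = n.
  by rewrite mem_strip => /hG /= /andP[+ /eqP[]]; rewrite orbF.
have sizeG : size G = size GN + (size D1 + size A1) + (size U1 + size A2) + size GS.
  have -> : size D1 + size A1 = size GD by rewrite !size_filter addnC count_predC.
  have -> : size U1 + size A2 = size GU by rewrite !size_filter addnC count_predC.
  rewrite !size_strip -!size_filter; move: hG; rewrite -/(size _) /=.
  rewrite !size_filter; elim: (G) => //= w H IHH hH.
  rewrite IHH; last by move=> v hv; apply: hH; rewrite inE hv orbT.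
  have := hH w; rewrite inE eqxx => /(_ isT).
  case: w {hH} => [|a [|c w]] //= /andP[hv _].
    by move: hv; rewrite !andbF.
  rewrite !eqseq_cons take0 eqxx !andbT.
  by move: hv; case: a => [|[|[|a]]] //=; case: c => [|[|[|[|c]]]] //= _; lia.
(* An edge joining the last two vertices is destroyed by the contraction; the rest of its word is
   all zeros. *)
have sS : size GS <= 1.
  have uS := strip_uniq [:: 2; 2] uG; rewrite -/GS in uS.
  case: (GS) uS vS => [|u [|v H]] //= /andP[]; rewrite inE negb_or => /andP[neq _] _ h.
  have [|h1 s1] := h u; first by rewrite inE eqxx.
  have [|h2 s2] := h v; first by rewrite !inE eqxx orbT.
  by case/eqP: neq; apply: valid2_eq => //; lia.
pose Phi := GN ++ [seq 2 :: t | t <- D1 ++ U1].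
have inj2 : injective (cons 2) by move=> u v [].
have uPhi : uniq Phi.
  rewrite cat_uniq strip_uniq //= map_inj_uniq // cat_uniq !filter_uniq ?strip_uniq //=.
  rewrite andbT; apply/andP; split.
    apply/hasPn => _ /mapP[t ht ->]; move: ht; rewrite mem_cat !mem_filter.
    by rewrite -/(NM t) negb_or => /orP[/andP[/andP[]]|/andP[]].
  apply/hasPn => t; rewrite !mem_filter => /andP[_ ->].
  by rewrite orbT.
have lift w : w \in Phi -> [/\ valid0 w, size w = n & exists2 x, x \in G &
    x = 0 :: w \/ exists c t, [/\ w = 2 :: t, (c == 1) || (c == 3) & x = [:: 2, c & t]]].
  rewrite mem_cat => /orP[hN|/mapP[t]].
    have [v s] := vN _ hN; move: hN; rewrite mem_strip /= => hN.
    by split=> //; exists (0 :: w) => //; left.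
  rewrite mem_cat !mem_filter => /orP[/andP[_ hD]|/andP[_ hU]] ->.
    have [v s] := vD _ hD; move: hD; rewrite mem_strip => hD.
    by split=> //; exists [:: 2, 1 & t] => //; right; exists 1, t.
  have [v s] := vU _ hU; move: hU; rewrite mem_strip => hU.
  by split=> //; exists [:: 2, 3 & t] => //; right; exists 3, t.
(* A valid word begins with 0 or 2, so the merged position never carries a strict comparison. The
   alternation lies in the tails and survives in the preimages. *)
have fPhi : altfree j.+2 Phi.
  move=> u v hu hv neq b; apply/negP => h.
  have [vu su [x hx ex]] := lift _ hu.
  have [vv sv [y hy ey]] := lift _ hv.
  suff [nxy hxy] : x != y /\ altn b j.+2 x y by have /negP := fG _ _ hx hy nxy b.
  case: ex => [->|[c [t [eu hc ->]]]]; case: ey => [->|[c' [t' [ev hc' ->]]]].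
  - by split; [rewrite eqseq_cons eqxx | apply: altn_cons].
  - split=> //; move: vu su h; rewrite ev; case: (u) => // a w va _ h.
    do 2!apply: altn_cons; apply: altn_consN h.
    by case/orP: va => /andP[/eqP-> _]; case: (b).
  - split=> //; move: vv sv h; rewrite eu; case: (v) => // a w va _ h.
    do 2!apply: altn_cons; apply: altn_consN h.
    by case/orP: va => /andP[/eqP-> _]; case: (b).
  - split; first by move: neq; rewrite eu ev !eqseq_cons !eqxx /= negb_and => ->; rewrite orbT.
    do 2!apply: altn_cons; move: h; rewrite eu ev; apply: altn_consN.
    by rewrite /cmp; case: b.
(* Each tail in [A] has two preimages whose second letters are separated by [m]. For two alternating
   tails, preimages can be chosen with second letters ordered against the first comparison, which
   lengthens the alternation by one. *)
have bA (A : seq (seq nat)) m : uniq A ->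
    (forall t, t \in A -> [/\ valid1 t, (size t).+1 = n,
       exists a c, 0 < c <= m /\ [:: a, c & t] \in G &
       exists a c, m < c /\ [:: a, c & t] \in G]) ->
    size A <= (3 * n) ^ j.
  move=> uA hA; rewrite -(size_map (cons 2)).
  have uA2 : uniq (map (cons 2) A) by rewrite map_inj_uniq.
  have vA2 w : w \in map (cons 2) A -> [/\ valid0 w, size w = n & head 0 w = 2].
    by case/mapP => t /hA[v1 s1 _ _] ->.
  have fA2 : altfree j.+1 (map (cons 2) A).
    move=> _ _ /mapP[t ht ->] /mapP[s hs ->] neq b; apply/negP => h.
    have {}h : altn b j.+1 t s by apply: altn_consN h; rewrite /cmp; case: b.
    have {}neq : t != s by apply: contraNneq neq => ->.
    have key x y : x \in G -> y \in G -> forall a c a' c' b', x = [:: a, c & t] ->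
        y = [:: a', c' & s] -> cmp b' c c' -> b = ~~ b' -> False.
      move=> hx hy a c a' c' b' ex ey hc eb.
      have nxy : x != y by rewrite ex ey !eqseq_cons !negb_and neq !orbT.
      have /negP[] := fG _ _ hx hy nxy b'; rewrite ex ey; apply: altn_cons.
      by move: h; rewrite eb /= => ->; rewrite hc.
    have [_ _ [a1 [c1 [l1 g1]]] [a2 [c2 [l2 g2]]]] := hA _ ht.
    have [_ _ [a3 [c3 [l3 g3]]] [a4 [c4 [l4 g4]]]] := hA _ hs.
    case/andP: l1 => l1 l1'; case/andP: l3 => l3 l3'.
    case: b h key => h key.
      by apply: (key _ _ g2 g3 _ _ _ _ false erefl erefl) => //; exact: cmp_false (leq_ltn_trans l3' l2).
    by apply: (key _ _ g1 g4 _ _ _ _ true erefl erefl) => //; exact: cmp_true (leq_ltn_trans l1' l4).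
  case: j IH fA2 {fG fPhi} => [|j'] IH fA2; first exact: words_head2 uA2 vA2 fA2.
  by apply: IH => // w /vA2[-> -> _]; rewrite eqxx.
have sA1 : size A1 <= (3 * n) ^ j.
  apply: (bA _ 1); first by rewrite filter_uniq ?strip_uniq.
  move=> t; rewrite mem_filter => /andP[h hD]; have [v s] := vD _ hD.
  split=> //; first by exists 2, 1; split=> //; rewrite mem_strip in hD.
  by case/orP: h; rewrite /NM mem_strip => h; [exists 0, 2 | exists 2, 3].
have sA2 : size A2 <= (3 * n) ^ j.
  apply: (bA _ 2); first by rewrite filter_uniq ?strip_uniq.
  move=> t; rewrite mem_filter => /andP[h hU]; have [v s] := vU _ hU.
  split=> //; first by exists 0, 2; split=> //; rewrite /NM mem_strip in h.
  by exists 2, 3; split=> //; rewrite mem_strip in hU.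
have sPhi : size Phi <= (3 * n) ^ j.+1.
  by apply: IH => // w /lift[-> -> _]; rewrite eqxx.
have : size Phi = size GN + (size D1 + size U1) by rewrite size_cat size_map size_cat.
(* Origin of the factor 3: the increment [3 (3n+3)^j] pays for two surplus sets and the single word
   beginning with 2 2. *)
have : (3 * n) ^ j.+1 + 2 * (3 * n) ^ j + 1 <= (3 * n.+1) ^ j.+1.
  rewrite (_ : 3 * n.+1 = 3 * n + 3); last by lia.
  set a := 3 * n; have h1 : a ^ j <= (a + 3) ^ j by case: (j) => [|j'] //; rewrite leq_exp2r ?leq_addr.
  have h2 : 0 < (a + 3) ^ j by rewrite expn_gt0; lia.
  by rewrite !expnS mulnDl; nia.
by lia.
Qed.

(** * Edges relative to a sample *)

Definition passes (E : Type) (lf rt : E -> nat) (e : E) (z : nat) :=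
  lf e < z < rt e.

(* Vertices are numbered from left to right, [lf e] and [rt e] are the ends of
   [e], [ab e z] says that [e] passes above [z], [mt e f] that [e] and [f] meet
   between their ends and [lo e f] that [e] is below [f] somewhere. *)
Record layered (E : finType) (lf rt : E -> nat) (ab : E -> nat -> bool)
    (mt lo : rel E) : Prop := Layered {
  lf_lt_rt : forall e, lf e < rt e;
  lo_total : forall e f, e != f -> ~~ mt e f -> lf e < rt f -> lf f < rt e ->
    lo e f = ~~ lo f e;
  lo_vertex : forall e f z, ~~ mt e f -> passes lf rt e z -> passes lf rt f z ->
    ~~ ab e z -> ab f z -> lo e f;
  lo_left : forall e f, ~~ mt e f -> passes lf rt e (lf f) ->
    lo e f = ~~ ab e (lf f);
  lo_right : forall e f, ~~ mt e f -> passes lf rt e (rt f) ->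
    lo e f = ~~ ab e (rt f)
}.

Section Visibility.
Variables (E : finType) (lf rt : E -> nat) (ab : E -> nat -> bool) (mt lo : rel E).
Variable I : {set E}.

Definition good (f : E) := (f \notin I) && [forall h in I, ~~ mt f h].

Definition blocks (f : E) (z : nat) (h : E) :=
  [&& passes lf rt h z, ab h z == ab f z & if ab f z then lo h f else lo f h].

Definition sees (f : E) (z : nat) :=
  passes lf rt f z && [forall h in I, ~~ blocks f z h].

Definition wall (u : nat) := [exists h in I, (u == lf h) || (u == rt h)].

(** Only at a wall can a sampled edge start between two edges that were not separated before, so the
    sides at visible walls are all that must be remembered. *)
Definition code (f : E) (a b : nat) : seq bool :=
  [seq ab f u | u <- index_iota a b & wall u && sees f u].

Definition start_together (z : nat) (f g : E) :=
  [/\ lf f = z, lf g = z & forall h, h \in I -> lf h = z -> lo h f = lo h g].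

Definition pass_together (z : nat) (f g : E) :=
  [/\ sees f z, sees g z & ab f z = ab g z].

Lemma code_cat f a b c : a <= b -> b <= c -> code f a c = code f a b ++ code f b c.
Proof.
move=> ab' bc; rewrite /code -map_cat -filter_cat; congr map.
suff -> : index_iota a c = index_iota a b ++ index_iota b c by [].
rewrite /index_iota (_ : c - a = (b - a) + (c - b)) ?iotaD ?subnKC //.
by rewrite addnC addnBA // subnK.
Qed.

Lemma codeS f a b : a <= b ->
  code f a b.+1 = code f a b ++ (if wall b && sees f b then [:: ab f b] else [::]).
Proof.
move=> le; rewrite (@code_cat f a b b.+1) // /code /index_iota subSnn /=.
by case: ifP.
Qed.

Hypothesis lay : layered lf rt ab mt lo.

Lemma good_mt f h : good f -> h \in I -> ~~ mt f h.
Proof. by case/andP => _ /forall_inP; apply. Qed.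

Lemma good_neq f h : good f -> h \in I -> f != h.
Proof. by case/andP => fI _ hI; apply: contraNneq fI => ->. Qed.

Variable mt_sym : symmetric mt.

Lemma good_asym f h : good f -> h \in I -> lf f < rt h -> lf h < rt f ->
  lo f h = ~~ lo h f.
Proof.
move=> gf hI; apply: (lo_total lay); [exact: good_neq|exact: good_mt].
Qed.

(** Different sides are tolerated only at a visible vertex that is no end of a sampled edge. This is
    the freedom left inside a class, which the local bound then measures. *)
Definition agree (f g : E) (u : nat) :=
  sees f u = sees g u /\ (ab f u <> ab g u -> sees f u /\ ~~ wall u).

(* A sampled edge [h] running between [f] and [g] starts either before [z], where
   it would already hide one of them, or at a wall that separates them. *)
Lemma no_separator z v f g h : good f -> good g ->
  start_together z f g \/ pass_together z f g ->
  z < v -> v <= rt f -> v <= rt g ->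
  (forall u, z < u < v -> agree f g u) ->
  h \in I -> lf h < v < rt h -> lo f h -> lo h g -> False.
Proof.
move=> gf gg tog zv vf vg ag hI /andP[hv vh] fh hg.
have lfz : lf f <= z.
  by case: tog => [[-> _ _]|[/andP[/andP[/ltnW]]]].
have lgz : lf g <= z.
  by case: tog => [[_ -> _]|[_ /andP[/andP[/ltnW]]]].
have lt_ba a b c d : a <= b -> b < c -> c < d -> a < d.
  by move=> h1 h2 h3; exact: leq_ltn_trans h1 (ltn_trans h2 h3).
have hf' : ~~ lo h f.
  by rewrite -(good_asym gf) //; [exact: (lt_ba _ z v) | exact: leq_trans vf].
have gh' : ~~ lo g h.
  by rewrite (good_asym gg) ?hg //; [exact: (lt_ba _ z v) | exact: leq_trans vg].
have mf := good_mt gf hI; have mg := good_mt gg hI.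
have mf' : ~~ mt h f by rewrite mt_sym.
have mg' : ~~ mt h g by rewrite mt_sym.
case: (ltngtP (lf h) z) => [hz|zh|hz].
- have ph : passes lf rt h z by rewrite /passes hz (ltn_trans zv).
  case: tog => [[ef eg _]|[/andP[pf /forall_inP/(_ h hI) bf] /andP[pg /forall_inP/(_ h hI) bg] e]].
    have := lo_left lay mf'; rewrite ef => /(_ ph) ef'.
    have := lo_left lay mg'; rewrite eg => /(_ ph) eg'.
    by move: hf'; rewrite ef' -eg' hg.
  move: bf bg; rewrite /blocks ph -e /=.
  case E1 : (ab f z); case E2 : (ab h z) => //=; rewrite ?fh ?hg //= => _ _.
    by move: hf'; rewrite (lo_vertex lay mf' ph pf) ?E2 ?E1.
  by move: gh'; rewrite (lo_vertex lay mg pg ph) ?E2 -?e ?E1.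
(* Here [f] and [g] pass the left end of [h] on opposite sides, which agreement forbids at a
   wall. *)
- have [] := ag (lf h); first by rewrite zh.
  have pf : passes lf rt f (lf h) by rewrite /passes (leq_ltn_trans lfz) // (leq_trans hv).
  have pg : passes lf rt g (lf h) by rewrite /passes (leq_ltn_trans lgz) // (leq_trans hv).
  have ef := lo_left lay mf pf; have eg := lo_left lay mg pg.
  move=> _ []; first by move: fh gh'; rewrite ef eg => /negbTE -> /negbNE ->.
  by move=> _ /negP[]; apply/exists_inP; exists h; rewrite ?eqxx.
- case: tog => [[ef eg /(_ h hI hz)]|[/andP[pf _] /andP[pg _] e]].
    by rewrite hg (negbTE hf').
  have := lo_left lay mf; rewrite hz => /(_ pf) e1.
  have := lo_left lay mg; rewrite hz => /(_ pg) e2.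
  by move: fh gh'; rewrite e1 e2 e => ->.
Qed.

(** Induction from left to right. Agreement before [v] makes the codes up to [v] coincide, so at a
    visible wall [v] the next bits coincide too; everything else follows from the absence of
    separators. *)
Lemma explore z N f g : good f -> good g ->
  start_together z f g \/ pass_together z f g ->
  code f z.+1 N = code g z.+1 N ->
  forall v, z < v -> v < N -> passes lf rt f v -> passes lf rt g v -> agree f g v.
Proof.
move=> gf gg tog ecode v; elim/ltn_ind: v => v IH zv vN pf pg.
have lfz : lf f <= z by case: tog => [[-> _ _]|[/andP[/andP[/ltnW]]]].
have lgz : lf g <= z by case: tog => [[_ -> _]|[_ /andP[/andP[/ltnW]]]].
have vf : v <= rt f by case/andP: pf => _ /ltnW.
have vg : v <= rt g by case/andP: pg => _ /ltnW.
have ag u : z < u < v -> agree f g u.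
  move=> /andP[zu uv]; apply: IH => //; first exact: ltn_trans vN.
    by apply/andP; split; [exact: leq_ltn_trans zu | exact: leq_trans vf].
  by apply/andP; split; [exact: leq_ltn_trans zu | exact: leq_trans vg].
have agC u : z < u < v -> agree g f u.
  by move=> /ag[e h]; split=> // n; have [|? ?] := h; [move/esym | rewrite -e].
have togC : start_together z g f \/ pass_together z g f.
  case: tog => [[? ? h]|[? ? ?]]; [left|right]; split=> //.
  by move=> h' hI hz; rewrite h.
(* A sampled edge hiding [v] from [f2] lies between [f1] and [f2] as soon as [f1] sees [v] or runs
   on its other side. *)
have sep f1 f2 : good f1 -> good f2 -> passes lf rt f1 v -> passes lf rt f2 v ->
    v <= rt f1 -> v <= rt f2 ->
    start_together z f1 f2 \/ pass_together z f1 f2 ->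
    start_together z f2 f1 \/ pass_together z f2 f1 ->
    (forall u, z < u < v -> agree f1 f2 u) ->
    (forall u, z < u < v -> agree f2 f1 u) ->
    ~~ sees f2 v -> ~ (sees f1 v || (ab f1 v != ab f2 v)).
  move=> g1 g2 p1 p2 v1 v2 t12 t21 a12 a21.
  rewrite /sees p2 /= => /forall_inPn[h hI /negPn/and3P[ph /eqP eh bh]] h1.
  have m1 := good_mt g1 hI; have m1' : ~~ mt h f1 by rewrite mt_sym.
  have o1 : lf f1 < rt h by move: ph p1; rewrite /passes; clear; lia.
  have o2 : lf h < rt f1 by move: ph p1; rewrite /passes; clear; lia.
  have A1 := good_asym g1 hI o1 o2.
  case E2 : (ab f2 v) in eh bh h1 *.
    apply: (no_separator g1 g2 t12 zv v1 v2 a12 hI ph _ bh).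
    case E1 : (ab f1 v) in h1 *; last by apply: (lo_vertex lay m1 p1 ph); rewrite ?E1.
    move: h1; rewrite orbF => /andP[_ /forall_inP/(_ h hI)].
    by rewrite /blocks ph E1 eh eqxx /= A1.
  apply: (no_separator g2 g1 t21 zv v2 v1 a21 hI ph bh _).
  case E1 : (ab f1 v) in h1 *; first by apply: (lo_vertex lay m1' ph p1); rewrite ?E1 ?eh.
  move: h1; rewrite orbF => /andP[_ /forall_inP/(_ h hI)].
  by rewrite /blocks ph E1 eh eqxx /= A1 negbK.
have es : sees f v = sees g v.
  case E1 : (sees f v); case E2 : (sees g v) => //.
    by case: (sep f g) => //; rewrite ?E1 ?E2.
  by case: (sep g f) => //; rewrite ?E1 ?E2.
split=> // nab; have sf : sees f v.
  case E1 : (sees f v) => //; case: (sep f g); rewrite ?E1 ?orFb -?es ?E1 //.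
  exact/eqP.
split=> //; apply/negP => wv; apply: nab.
have pre : code f z.+1 v = code g z.+1 v.
  rewrite /code; have -> : [seq u <- index_iota z.+1 v | wall u && sees f u] =
     [seq u <- index_iota z.+1 v | wall u && sees g u].
    by apply: eq_in_filter => u; rewrite mem_index_iota => hu; have [-> _] := ag u hu.
  apply/eq_in_map => u; rewrite mem_filter mem_index_iota => /andP[/andP[wu _] hu].
  have [_ h] := ag u hu; apply/eqP; apply: contraT => /eqP /h[_].
  by rewrite wu.
move: ecode; rewrite (@code_cat f z.+1 v N) ?(@code_cat g z.+1 v N) //; try exact: ltnW.
rewrite pre => /eqP; rewrite eqseq_cat // eqxx /= => /eqP.
rewrite (@code_cat f v v.+1 N) ?(@code_cat g v v.+1 N) // !codeS //.
by rewrite wv -es sf /code /index_iota subnn /= => -[].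
Qed.

(** A sampled edge hiding the right end of [f] from [g] would run between the two edges. This places
    the ends of a class among the vertices seen by its longest member. *)
Lemma explore_end z N f g : good f -> good g ->
  start_together z f g \/ pass_together z f g ->
  code f z.+1 N = code g z.+1 N -> rt g <= N ->
  z < rt f -> rt f < rt g -> sees g (rt f).
Proof.
move=> gf gg tog ec gN zf fg; have lg : lf g <= z.
  by case: tog => [[_ -> _]|[_ /andP[/andP[/ltnW]]]].
have lf' : lf f <= z.
  by case: tog => [[-> _ _]|[/andP[/andP[/ltnW]]]].
have ag u : z < u < rt f -> agree f g u.
  move=> hu; apply: (explore gf gg tog ec); rewrite /passes; move: hu gN zf fg lf' lg; clear; lia.
have agC u : z < u < rt f -> agree g f u.
  by move=> /ag[e h]; split=> // n; have [|? ?] := h; [move/esym | rewrite -e].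
have togC : start_together z g f \/ pass_together z g f.
  case: tog => [[? ? h]|[? ? ?]]; [left|right]; split=> //.
  by move=> h' hI hz; rewrite h.
have pg : passes lf rt g (rt f) by rewrite /passes (leq_ltn_trans lg).
rewrite /sees pg /=; apply/forall_inP => h hI; apply/negP => /and3P[ph /eqP eh bh].
have m1 := good_mt gf hI; have m1' : ~~ mt h f by rewrite mt_sym.
have R1 := lo_right lay m1' ph.
have o1 : lf f < rt h by move: ph lf' zf; rewrite /passes; clear; lia.
have o2 : lf h < rt f by move: ph lf' zf; rewrite /passes; clear; lia.
have A1 := good_asym gf hI o1 o2.
case E2 : (ab g (rt f)) in eh bh.
  apply: (no_separator gf gg tog zf (leqnn _) (ltnW fg) ag hI ph _ bh).
  by rewrite A1 R1 eh.
apply: (no_separator gg gf togC zf (ltnW fg) (leqnn _) agC hI ph bh _).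
by rewrite R1 eh.
Qed.

End Visibility.

(** * Left-right reflection of the layered data *)

Section Mirror.
Variables (E : finType) (lf rt : E -> nat) (ab : E -> nat -> bool) (mt lo : rel E).
Variables (I : {set E}) (N : nat).
Hypothesis lay : layered lf rt ab mt lo.
Hypothesis rtN : forall e, rt e < N.

Let lf' e := N - rt e.
Let rt' e := N - lf e.
Let ab' e z := ab e (N - z).

Lemma passes_mirror e u : u <= N -> passes lf' rt' e (N - u) = passes lf rt e u.
Proof.
move=> uN; rewrite /passes /lf' /rt'; move: (rtN e) (lf_lt_rt lay e) uN.
by clear; lia.
Qed.

Lemma sees_mirror f u : u <= N ->
  sees lf' rt' ab' lo I f (N - u) = sees lf rt ab lo I f u.
Proof.
move=> uN; rewrite /sees passes_mirror //; congr (_ && _).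
by apply: eq_forallb_in => h _; rewrite /blocks passes_mirror // /ab' subKn.
Qed.

Lemma wall_mirror u : u <= N -> wall lf' rt' I (N - u) = wall lf rt I u.
Proof.
move=> uN; apply: eq_existsb => h; rewrite orbC; congr (_ && _).
by rewrite /rt' /lf'; congr (_ || _); move: (rtN h) (lf_lt_rt lay h) uN; clear; lia.
Qed.

Lemma layered_mirror : layered lf' rt' ab' mt lo.
Proof.
have ln e : lf e <= N by apply: ltnW; apply: ltn_trans (rtN e); exact: lf_lt_rt lay e.
have rn e : rt e <= N by exact: ltnW.
split.
- by move=> e; rewrite /lf' /rt'; move: (rtN e) (lf_lt_rt lay e); clear; lia.
- move=> e f nef m h1 h2; apply: (lo_total lay) => //; move: h1 h2; rewrite /lf' /rt'.
    by clear; lia.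
  by clear; lia.
- move=> e f z m pe pf; have zN : z <= N.
    by move: pe; rewrite /passes /rt'; clear; lia.
  move: pe pf; rewrite -(subKn zN); move: (N - z) (leq_subr z N) => w wN.
  rewrite !passes_mirror // /ab' subKn //. move=> p q. exact (lo_vertex lay m p q).
- move=> e f m; rewrite /lf' passes_mirror // => p; rewrite /ab' subKn //.
  exact (lo_right lay m p).
- move=> e f m; rewrite /rt' passes_mirror // => p; rewrite /ab' subKn //.
  exact (lo_left lay m p).
Qed.

End Mirror.

(** * Counting a class of agreeing edges *)

Section ClassBound.
Variables (E : finType) (lf rt : E -> nat) (ab : E -> nat -> bool) (mt lo : rel E).
Variables (N D : nat).
Hypothesis lay : layered lf rt ab mt lo.
Hypothesis mt_sym : symmetric mt.
Hypothesis rtN : forall e, rt e < N.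

Definition separated (Z : seq nat) (G : {set E}) :=
  forall f g, f \in G -> g \in G -> f != g -> lf f = lf g -> rt f = rt g ->
    exists2 u, u \in Z & passes lf rt f u /\ ab f u <> ab g u.

(** The hypotheses on crossings of (a), (b) and (c) enter only through the exponent [D] of this
    bound. *)
Definition local_bound := forall (Z : seq nat) (G : {set E}), uniq Z ->
  (forall f, f \in G -> lf f \in Z /\ rt f \in Z) -> separated Z G ->
  #|G| <= (3 * size Z) ^ D.

Hypothesis nonhom : separated (iota 0 N) [set: E].
Hypothesis HD : local_bound.

Variable I : {set E}.
Local Notation seesI := (sees lf rt ab lo I).
Local Notation agreeI := (agree lf rt ab lo I).

Definition vis (f : E) := [seq u <- iota 0 N | seesI f u].

Lemma mem_vis f u : (u \in vis f) = seesI f u.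
Proof.
rewrite mem_filter mem_iota add0n /= andb_idr // => /andP[/andP[_ h] _].
exact: ltn_trans (rtN f).
Qed.

(** Two members witness the whole class: [fL] reaches farthest left and [fR] farthest right. Every
    end, and a vertex distinguishing any two parallel members, is seen by one of them, apart from
    [z] and the two extreme ends. These three and the two visible sets give [2 * m + 3]. *)
Lemma class_bound (T : {set E}) (z m : nat) :
  (forall f g (v : nat), f \in T -> g \in T -> v != z -> passes lf rt f v ->
     passes lf rt g v -> agreeI f g v) ->
  (forall f g, f \in T -> g \in T -> z < rt f -> rt f < rt g -> seesI g (rt f)) ->
  (forall f g, f \in T -> g \in T -> lf g < lf f -> lf f < z -> seesI g (lf f)) ->
  (forall f, f \in T -> lf f <= z < rt f) ->
  (forall f g, f \in T -> g \in T -> passes lf rt f z -> passes lf rt g z ->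
     ab f z = ab g z) ->
  (forall f, f \in T -> size (vis f) <= m) ->
  #|T| <= (3 * (2 * m + 3)) ^ D.
Proof.
move=> hA hR hL hC hP hm.
case: (set_0Vmem T) => [->|[f0 f0T]]; first by rewrite cards0.
pose fR := [arg max_(f > f0 in T) rt f]; pose fL := [arg min_(f < f0 in T) lf f].
have [fRT mR] : fR \in T /\ forall f, f \in T -> rt f <= rt fR.
  by rewrite /fR; case: arg_maxnP.
have [fLT mL] : fL \in T /\ forall f, f \in T -> lf fL <= lf f.
  by rewrite /fL; case: arg_minnP.
pose Z := undup ([:: z; lf fL; rt fR] ++ vis fL ++ vis fR).
have sZ : size Z <= 2 * m + 3.
  apply: leq_trans (size_undup _) _; rewrite !size_cat /=.
  by move: (hm _ fRT) (hm _ fLT); clear; lia.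
apply: leq_trans (_ : (3 * size Z) ^ D <= _); last first.
  by case: D => // D'; rewrite leq_exp2r // leq_mul2l sZ orbT.
apply: HD; first exact: undup_uniq.
  move=> f fT; have /andP[lz zr] := hC _ fT; rewrite !mem_undup !mem_cat !inE !mem_vis; split.
    move: lz; rewrite leq_eqVlt => /orP[->//|lz].
    have := mL f fT; rewrite leq_eqVlt => /orP[/eqP->|h]; first by rewrite eqxx !orbT.
    by rewrite (hL f fL) ?orbT.
  have := mR f fT; rewrite leq_eqVlt => /orP[/eqP->|h]; first by rewrite eqxx !orbT.
  by rewrite (hR f fR) ?orbT.
move=> f g fT gT nfg el er.
have [u _ [pf dab]] := nonhom (finset.in_setT f) (finset.in_setT g) nfg el er.
exists u => //; have pg : passes lf rt g u by move: pf; rewrite /passes el er.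
have uz : u != z by apply/eqP => uz; apply: dab; rewrite uz; apply: hP => //; rewrite -uz.
have [_ /(_ dab)[sfu _]] := hA _ _ _ fT gT uz pf pg.
rewrite mem_undup !mem_cat !mem_vis; have /andP[lu ur] := pf.
case: (ltngtP u z) (uz) => // uz' _.
  have p : passes lf rt fL u.
    have /andP[_ h] := hC _ fLT; rewrite /passes (leq_ltn_trans (mL _ fT)) //.
    exact: ltn_trans uz' h.
  by have [<- _] := hA _ _ _ fT fLT uz pf p; rewrite sfu !orbT.
have p : passes lf rt fR u.
  have /andP[h _] := hC _ fRT; rewrite /passes (leq_ltn_trans h) //=.
  exact: leq_trans ur (mR _ fT).
by have [<- _] := hA _ _ _ fT fRT uz pf p; rewrite sfu !orbT.
Qed.

Definition nwalls (f : E) := count (fun u => wall lf rt I u && seesI f u) (iota 0 N).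

Lemma size_code f a b : b <= N -> size (code lf rt ab lo I f a b) <= nwalls f.
Proof.
move=> bN; rewrite size_map size_filter /nwalls.
case: (leqP a b) => [le|/ltnW lt]; last first.
  by rewrite /index_iota (eqP (_ : b - a == 0)) ?subn_eq0 //.
have eb : iota 0 N = iota 0 b ++ iota b (N - b).
  by have := iotaD 0 b (N - b); rewrite subnKC.
have ea : iota 0 b = iota 0 a ++ index_iota a b.
  by have := iotaD 0 a (b - a); rewrite subnKC.
by rewrite eb ea !count_cat -addnA addnCA leq_addr.
Qed.

End ClassBound.

Lemma card_fibres (T C : finType) (S : {set T}) (c : T -> C) b :
  (forall y, #|[set x in S | c x == y]| <= b) -> #|S| <= #|C| * b.
Proof.
move=> h; rewrite -sum1_card (partition_big c predT) //= -sum_nat_const.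
apply: leq_sum => y _; apply: leq_trans (h y).
by rewrite -sum1_card; apply: eq_leq; apply: eq_bigl => x; rewrite inE.
Qed.

(** Padding with [false] puts short codes into a finite type; the recorded length keeps this
    injective. *)
Definition bits (B : nat) (s : seq bool) : 'I_B.+1 * {ffun 'I_B -> bool} :=
  (inord (size s), [ffun i : 'I_B => nth false s i]).

Lemma bits_inj B s t : size s <= B -> size t <= B -> bits B s = bits B t -> s = t.
Proof.
move=> sB tB [/(congr1 (@nat_of_ord _))]; rewrite !inordK // => es /ffunP et.
apply: (@eq_from_nth _ false) => // i iB.
by have := et (Ordinal (leq_trans iB sB)); rewrite !ffunE.
Qed.

Lemma card_bits B : #|{: 'I_B.+1 * {ffun 'I_B -> bool}}| = B.+1 * 2 ^ B.
Proof. by rewrite card_prod card_ffun card_bool !card_ord. Qed.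

(** * Classes of edges through a common anchor *)

Section Anchors.
Variables (E : finType) (lf rt : E -> nat) (ab : E -> nat -> bool) (mt lo : rel E).
Variables (N D : nat).
Hypothesis lay : layered lf rt ab mt lo.
Hypothesis mt_sym : symmetric mt.
Hypothesis rtN : forall e, rt e < N.
Hypothesis nonhom : separated lf rt ab (iota 0 N) [set: E].
Hypothesis HD : local_bound lf rt ab D.
Variable I : {set E}.
Local Notation seesI := (sees lf rt ab lo I).
Local Notation agreeI := (agree lf rt ab lo I).
Local Notation goodI := (good mt I).
Local Notation visI := (vis lf rt ab lo N I).
Local Notation nwallsI := (nwalls lf rt ab lo N I).

Definition codeR (f : E) (z : nat) := code lf rt ab lo I f z.+1 N.
Definition codeL (f : E) (z : nat) :=
  code (fun e => N - rt e) (fun e => N - lf e) (fun e u => ab e (N - u)) lo I f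
    (N - z).+1 N.+1.

Lemma size_codeL f z : size (codeL f z) <= nwallsI f.
Proof.
rewrite /nwallsI -size_filter size_map -(size_map (fun w => N - w)).
apply: uniq_leq_size.
  rewrite map_inj_in_uniq ?filter_uniq ?iota_uniq // => u v.
  rewrite !mem_filter !mem_index_iota => /andP[_ /andP[_ uN]] /andP[_ /andP[_ vN]].
  by move: uN vN; clear; lia.
move=> _ /mapP[w + ->]; rewrite !mem_filter mem_index_iota => /andP[/andP[h1 h2] /andP[zw wN]].
have := leq_subr w N; move: h1 h2; rewrite -{1 2}(subKn (wN : w <= N)).
rewrite (wall_mirror _ lay rtN) ?leq_subr // (sees_mirror _ lay rtN) ?leq_subr // => -> -> _.
by rewrite mem_iota; move: zw wN; clear; lia.
Qed.

Lemma agreeR z f g : goodI f -> goodI g ->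
  start_together lf lo I z f g \/ pass_together lf rt ab lo I z f g ->
  codeR f z = codeR g z ->
  forall v, z < v -> passes lf rt f v -> passes lf rt g v -> agreeI f g v.
Proof.
move=> gf gg tog ec v zv pf pg; apply: (explore lay mt_sym gf gg tog ec) => //.
by case/andP: pf => _ h; exact: ltn_trans (rtN f).
Qed.

Lemma endR z f g : goodI f -> goodI g ->
  start_together lf lo I z f g \/ pass_together lf rt ab lo I z f g ->
  codeR f z = codeR g z -> z < rt f -> rt f < rt g -> seesI g (rt f).
Proof.
by move=> gf gg tog ec; apply: (explore_end lay mt_sym gf gg tog ec); exact: ltnW.
Qed.

Lemma pass_mirror z f g : z <= N -> pass_together lf rt ab lo I z f g ->
  pass_together (fun e => N - rt e) (fun e => N - lf e) (fun e u => ab e (N - u))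
    lo I (N - z) f g.
Proof.
move=> zN [sf sg e]; split; rewrite ?(sees_mirror _ lay rtN) //.
by rewrite subKn.
Qed.

Lemma agreeL z f g : z <= N -> goodI f -> goodI g -> pass_together lf rt ab lo I z f g ->
  codeL f z = codeL g z ->
  forall v, v < z -> passes lf rt f v -> passes lf rt g v -> agreeI f g v.
Proof.
move=> zN gf gg tog ec v vz pf pg; have vN : v <= N by exact: leq_trans (ltnW vz) zN.
have /(_ (N - v)) := explore (layered_mirror lay rtN) mt_sym gf gg
  (or_intror (pass_mirror zN tog)) ec.
rewrite !(passes_mirror lay rtN) // /agree !(sees_mirror _ lay rtN) // !(wall_mirror _ lay rtN) // subKn //.
by apply=> //; move: vz zN; clear; lia.
Qed.

Lemma endL z f g : z <= N -> goodI f -> goodI g -> pass_together lf rt ab lo I z f g ->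
  codeL f z = codeL g z -> lf g < lf f -> lf f < z -> seesI g (lf f).
Proof.
move=> zN gf gg tog ec gf' fz; have fN : lf f <= N by exact: leq_trans (ltnW fz) zN.
have := explore_end (layered_mirror lay rtN) mt_sym gf gg
  (or_intror (pass_mirror zN tog)) ec.
rewrite (sees_mirror _ lay rtN) //; apply; move: gf' fz fN zN; clear; lia.
Qed.

Definition ncodes (B : nat) := B.+1 * 2 ^ B.

Definition tame (B m : nat) :=
  [set f | [&& goodI f, nwallsI f <= B & size (visI f) <= m]].

(** The edge is followed in both directions from [z]; with at most [B] visible walls there are
    [ncodes B] codes on each side, and equal pairs of codes form one class. *)
Lemma pass_anchor B m z (s : bool) : z <= N ->
  #|[set f in tame B m | seesI f z && (ab f z == s)]| <=
    ncodes B * (ncodes B * (3 * (2 * m + 3)) ^ D).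
Proof.
move=> zN; rewrite /ncodes -{1}card_bits.
apply: (card_fibres (c := fun f => bits B (codeR f z))) => yR.
rewrite -{1}card_bits.
apply: (card_fibres (c := fun f => bits B (codeL f z))) => yL.
set T := [set x in _ | _].
have hT f g : f \in T -> g \in T ->
  [/\ goodI f /\ goodI g, pass_together lf rt ab lo I z f g, codeR f z = codeR g z,
      codeL f z = codeL g z & size (visI f) <= m].
  rewrite !inE => /andP[/andP[/andP[/and3P[gf wf vf] /andP[sf /eqP af]] /eqP rf] /eqP lf'].
  move=> /andP[/andP[/andP[/and3P[gg wg vg] /andP[sg /eqP ag]] /eqP rg] /eqP lg].
  split=> //; first by split=> //; rewrite af ag.
    apply: (bits_inj (B := B)); rewrite ?rf ?rg //.
      by apply: leq_trans wf; exact: size_code.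
    by apply: leq_trans wg; exact: size_code.
  apply: (bits_inj (B := B)); rewrite ?lf' ?lg //.
    by apply: leq_trans wf; exact: size_codeL.
  by apply: leq_trans wg; exact: size_codeL.
apply: (class_bound rtN nonhom HD (I := I) (lo := lo) (z := z)).
- move=> f g v fT gT vz pf pg; have [[gf gg] tog eR eL _] := hT _ _ fT gT.
  case: (ltngtP v z) vz => // vz _; first exact: (agreeL zN gf gg tog eL).
  exact: (agreeR gf gg (or_intror tog) eR).
- move=> f g fT gT; have [[gf gg] tog eR _ _] := hT _ _ fT gT.
  exact: (endR gf gg (or_intror tog) eR).
- move=> f g fT gT; have [[gf gg] tog _ eL _] := hT _ _ fT gT.
  exact: (endL zN gf gg tog eL).
- move=> f fT; have [_ [/andP[/andP[h1 h2] _] _ _] _ _ _] := hT _ _ fT fT.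
  by rewrite (ltnW h1).
- by move=> f g fT gT _ _; have [_ [_ _ ->] _ _ _] := hT _ _ fT gT.
- by move=> f fT; have [_ _ _ _] := hT _ _ fT fT.
Qed.

Definition wedge (f : E) := [set h in I | (lf h == lf f) && lo h f].

Variable rs : E -> nat.
Hypothesis rs_lo : forall f h, lf f = lf h -> f != h -> ~~ mt f h ->
  (rs h < rs f) = lo h f.

(** The sampled edges below a good edge at its left end form an initial segment for [rs], hence are
    determined by their number. *)
Lemma wedge_eq f g : goodI f -> goodI g -> lf f = lf g ->
  #|wedge f| = #|wedge g| -> wedge f = wedge g.
Proof.
have ew f' h : goodI f' -> lf f' = lf h -> h \in I -> lo h f' = (rs h < rs f').
  move=> g' e hI; rewrite rs_lo //; [exact: good_neq g' hI|exact: good_mt g' hI].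
wlog le : f g / rs f <= rs g => [hw gf gg e ec|gf gg e ec].
  by case/orP: (leq_total (rs f) (rs g)) => le; [|apply/esym]; apply: hw.
apply/eqP; rewrite eqEcard ec leqnn andbT; apply/fintype.subsetP => h.
rewrite !inE => /and3P[hI /eqP hf]; rewrite ew // => h1.
by rewrite hI hf e eqxx ew ?(leq_trans h1) //= -e.
Qed.

(** An edge may see no vertex at all, so its left end also serves as an anchor; the code to the
    right is then enough. *)
Lemma start_anchor B m z c : 
  #|[set f in tame B m | (lf f == z) && (#|wedge f| == c)]| <=
    ncodes B * (3 * (2 * m + 3)) ^ D.
Proof.
rewrite /ncodes -{1}card_bits.
apply: (card_fibres (c := fun f => bits B (codeR f z))) => yR.
set T := [set x in _ | _].
have hT f g : f \in T -> g \in T ->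
  [/\ goodI f /\ goodI g, start_together lf lo I z f g, codeR f z = codeR g z &
      size (visI f) <= m].
  rewrite !inE => /andP[/andP[/and3P[gf wf vf] /andP[/eqP lf' /eqP cf]] /eqP rf].
  move=> /andP[/andP[/and3P[gg wg vg] /andP[/eqP lg /eqP cg]] /eqP rg].
  split=> //; last first.
    apply: (bits_inj (B := B)); rewrite ?rf ?rg //.
      by apply: leq_trans wf; exact: size_code.
    by apply: leq_trans wg; exact: size_code.
  split=> // h hI hz; have := wedge_eq gf gg.
  rewrite lf' lg cf cg => /(_ erefl erefl)/setP/(_ h).
  by rewrite !inE hI hz lf' lg eqxx.
apply: (class_bound rtN nonhom HD (I := I) (lo := lo) (z := z)).
- move=> f g v fT gT vz pf pg; have [[gf gg] tog eR _] := hT _ _ fT gT.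
  apply: (agreeR gf gg (or_introl tog) eR) => //.
  by case: tog => fz _ _; case/andP: pf; rewrite fz.
- move=> f g fT gT; have [[gf gg] tog eR _] := hT _ _ fT gT.
  exact: (endR gf gg (or_introl tog) eR).
- by move=> f g fT gT; have [_ [-> _ _] _ _] := hT _ _ fT gT; rewrite ltnn.
- by move=> f fT; have [_ [h _ _] _ _] := hT _ _ fT fT; rewrite -h leqnn (lf_lt_rt lay).
- move=> f g fT gT /andP[h _]; have [_ [h' _ _] _ _] := hT _ _ fT gT.
  by rewrite h' ltnn in h.
- by move=> f fT; have [_ _ _] := hT _ _ fT fT.
Qed.

End Anchors.

(** * Random samples *)

Section Colourings.
Variables (E : finType) (p : nat).
Local Notation q := p.+1.
Local Notation colouring := {ffun E -> 'I_q}.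

(** Probability [1/q] is realised by uniform colourings with [q] colours, so expectations become
    sums over colourings divided by [q ^ #|E|]. *)
Definition sample (c : colouring) : {set E} := [set h | c h == ord0].

Definition avoiding (J : {set E}) : {set colouring} :=
  [set c | [disjoint J & sample c]].

Lemma avoidingP (J : {set E}) (c : colouring) :
  reflect (forall h, h \in J -> h \notin sample c) (c \in avoiding J).
Proof.
rewrite inE disjoint_subset; apply: (iffP fintype.subsetP) => h x xJ; exact: h.
Qed.

Lemma card_avoiding J : #|avoiding J| = p ^ #|J| * q ^ (#|E| - #|J|).
Proof.
pose F x : {pred 'I_q} := if x \in J then predC1 ord0 else predT.
rewrite (eq_card (B := family F)).
  rewrite card_family foldrE big_map big_enum /=.
  rewrite (bigID (mem J)) /= (eq_bigr (fun=> p)); last first.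
    by move=> x xJ; rewrite /F xJ cardC1 card_ord.
  rewrite prod_nat_const; congr (_ * _).
  rewrite (eq_bigr (fun=> q)); last first.
    by move=> x xJ; rewrite /F (negbTE xJ) cardT size_enum_ord.
  rewrite prod_nat_const -(cardC J); congr (_ ^ _).
  by rewrite addKn; apply: eq_card => x; rewrite !inE.
move=> c; apply/avoidingP/familyP => [h x|h x xJ].
  by rewrite /F; case: ifP => // /h; rewrite !inE.
by have := h x; rewrite /F xJ !inE.
Qed.

(** Independence: the colour of [h0] is free of the colours on [J]. *)
Lemma card_avoiding_sampled (J : {set E}) h0 : h0 \notin J ->
  q * #|[set c in avoiding J | h0 \in sample c]| = #|avoiding J|.
Proof.
move=> h0J; have := card_avoiding (h0 |: J); rewrite cardsU1 h0J add1n.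
have := cardsID [set c | h0 \in sample c] (avoiding J).
have -> : avoiding J :&: [set c | h0 \in sample c] =
    [set c in avoiding J | h0 \in sample c].
  by apply/setP => c; rewrite !inE.
have -> : avoiding J :\: [set c | h0 \in sample c] = avoiding (h0 |: J).
  apply/setP => c; rewrite finset.in_setD inE; apply/idP/idP.
    move=> /andP[h1 /avoidingP h2]; apply/avoidingP => h.
    by rewrite finset.in_setU1 => /orP[/eqP->|/h2].
  move=> /avoidingP h; rewrite h ?setU11 //=; apply/avoidingP => h' h'J.
  by apply: h; rewrite finset.in_setU1 h'J orbT.
rewrite (card_avoiding J); have lt : #|J| < #|E|.
  by have := max_card (mem (h0 |: J)); rewrite cardsU1 h0J.
have -> : #|E| - #|J| = (#|E| - #|J|.+1).+1 by move: lt; clear; lia.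
rewrite !expnS; move: (p ^ _) (q ^ _) #|[set c in avoiding J | _]| => a b x.
by move=> h1 h2; move: h1; rewrite h2; clear; nia.
Qed.

(** Avoiding a set of size [j] has probability [(p/q)^j]; as the sizes are distinct, the
    probabilities sum to at most the geometric series, which is [q]. *)
Lemma sum_avoiding (S : {set E}) (B : E -> {set E}) :
  {in S &, injective (fun f => #|B f|)} ->
  \sum_(f in S) #|avoiding (B f)| <= q ^ #|E|.+1.
Proof.
move=> injB; pose w j := p ^ j * q ^ (#|E| - j).
pose r f : 'I_#|E|.+1 := inord #|B f|.
have rE f : r f = #|B f| :> nat by rewrite inordK // ltnS max_card.
have injr : {in S &, injective r}.
  by move=> f g fS gS /(congr1 (@nat_of_ord _)); rewrite !rE; exact: injB.
have -> : \sum_(f in S) #|avoiding (B f)| = \sum_(i in r @: S) w i.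
  rewrite big_imset //=; apply: eq_bigr => f _; rewrite rE; exact: card_avoiding.
apply: leq_trans (_ : \sum_(i < #|E|.+1) w i <= _).
  by rewrite [X in _ <= X](bigID (mem (r @: S))) /= leq_addr.
apply: leq_trans (leq_subr (p ^ #|E|.+1) _); rewrite subn_exp subSnn mul1n.
by apply: eq_leq; apply: eq_bigr => i _; rewrite mulnC.
Qed.

End Colourings.

Lemma card_set_exchange (A B : finType) (P : A -> B -> bool) :
  \sum_a #|[set b | P a b]| = \sum_b #|[set a | P a b]|.
Proof.
rewrite (eq_bigr (fun a => \sum_b P a b)); last first.
  by move=> a _; rewrite -sum1_card big_mkcond; apply: eq_bigr => b _; rewrite inE; case: ifP.
rewrite exchange_big; apply: eq_bigr => b _.
by rewrite -sum1_card [RHS]big_mkcond; apply: eq_bigr => a _; rewrite inE; case: ifP.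
Qed.

Lemma sum_eq_and (r : seq nat) (a : nat) (b : bool) : uniq r ->
  \sum_(u <- r) ((u == a) && b) <= b.
Proof.
case: b => ur; last by rewrite big1 // => u _; rewrite andbF.
apply: leq_trans (_ : count_mem a r <= _); last by rewrite count_uniq_mem // leq_b1.
by rewrite -sum1_count [X in _ <= X]big_mkcond; apply: leq_sum => u _; rewrite andbT /=; case: eqP.
Qed.

(** * Expected visibility under a random sample *)

Section Sampling.
Variables (E : finType) (lf rt : E -> nat) (ab : E -> nat -> bool) (mt lo : rel E).
Variables (N p : nat).
Local Notation q := p.+1.
Local Notation colouring := {ffun E -> 'I_q}.
Local Notation seesI c := (sees lf rt ab lo (sample c)).
Local Notation goodI c := (good mt (sample c)).
Hypothesis rtN : forall e, rt e < N.

Definition side (z : nat) (s : bool) := [set f | passes lf rt f z & ab f z == s].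

Variable rk : nat -> bool -> E -> nat.
Hypothesis rk_inj : forall z s, {in side z s &, injective (rk z s)}.
Hypothesis rk_lo : forall z s f h, f \in side z s -> h \in side z s -> ~~ mt f h ->
  rk z s h < rk z s f -> if s then lo h f else lo f h.

Definition nearer z s f := [set h in side z s | rk z s h < rk z s f].

(** Along one side the sets of nearer edges are strictly nested, which supplies the distinct sizes
    required by [sum_avoiding]. *)
Lemma card_nearer_inj z s : {in side z s &, injective (fun f => #|nearer z s f|)}.
Proof.
have lt f g : f \in side z s -> rk z s f < rk z s g -> #|nearer z s f| < #|nearer z s g|.
  move=> fS fg; apply: proper_card; apply/properP; split.
    by apply/fintype.subsetP => h; rewrite !inE => /andP[-> /ltn_trans]; apply.
  by exists f; rewrite inE ?fS ?ltnn ?andbF.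
move=> f g fS gS e; apply: rk_inj (fS) (gS) _.
case: (ltngtP (rk z s f) (rk z s g)) => // h.
  by have := lt _ _ fS h; rewrite e ltnn.
by have := lt _ _ gS h; rewrite e ltnn.
Qed.

Lemma sees_avoiding (c : colouring) z f : goodI c f -> seesI c f z ->
  c \in avoiding p (nearer z (ab f z) f).
Proof.
move=> gf /andP[pf /forall_inP sf]; apply/avoidingP => h; rewrite !inE => /andP[/andP[ph ah] r].
apply/negP => hc; have hI : h \in sample c by rewrite inE.
have := sf h hI; rewrite /blocks ph ah /= => /negP[].
apply: (@rk_lo z) => //; rewrite ?inE ?pf ?ph ?eqxx //.
exact: good_mt gf hI.
Qed.

Lemma sum_sees z : \sum_(c : colouring) #|[set f | goodI c f && seesI c f z]| <=
  2 * q ^ #|E|.+1.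
Proof.
rewrite card_set_exchange.
apply: leq_trans (_ : \sum_(s : bool) \sum_(f in side z s) #|avoiding p (nearer z s f)| <= _).
  rewrite (exchange_big_dep predT) //=; apply: leq_sum => f _.
  case: (boolP (passes lf rt f z)) => pf; last first.
    rewrite big_pred0 => [|s]; last by rewrite inE (negbTE pf).
    rewrite leqn0 cards_eq0; apply/eqP/setP => c; rewrite !inE /sees /= (negbTE pf).
    by rewrite andbF.
  rewrite (big_pred1 (ab f z)) => [|s]; last by rewrite inE pf eq_sym.
  apply: subset_leq_card; apply/fintype.subsetP => c; rewrite inE => /andP[gf sf].
  exact: sees_avoiding.
rewrite big_bool mul2n -addnn leq_add // sum_avoiding //; exact: card_nearer_inj.
Qed.

(** An edge that does not pass [z] never belongs to a set [nearer z s f], so its being sampled is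
    independent of the event that bounds visibility, and a factor [q] is gained over [sum_sees]. *)
Lemma sum_sees_sampled z h0 : ~~ passes lf rt h0 z ->
  \sum_(c : colouring) #|[set f | [&& h0 \in sample c, goodI c f & seesI c f z]]| <=
  2 * q ^ #|E|.
Proof.
move=> h0z; rewrite card_set_exchange.
apply: leq_trans (_ : \sum_(s : bool) \sum_(f in side z s)
    #|[set c in avoiding p (nearer z s f) | h0 \in sample c]| <= _).
  rewrite (exchange_big_dep predT) //=; apply: leq_sum => f _.
  case: (boolP (passes lf rt f z)) => pf; last first.
    rewrite big_pred0 => [|s]; last by rewrite inE (negbTE pf).
    rewrite leqn0 cards_eq0; apply/eqP/setP => c; rewrite !inE /sees /= (negbTE pf).
    by rewrite !andbF.
  rewrite (big_pred1 (ab f z)) => [|s]; last by rewrite inE pf eq_sym.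
  apply: subset_leq_card; apply/fintype.subsetP => c; rewrite inE => /and3P[hc gf sf].
  by rewrite inE hc andbT; exact: sees_avoiding.
rewrite big_bool mul2n -addnn.
have h s : \sum_(f in side z s) #|[set c in avoiding p (nearer z s f) | h0 \in sample c]|
    <= q ^ #|E|.
  rewrite -(leq_pmul2l (ltn0Sn p)) big_distrr /= -expnS.
  apply: leq_trans (sum_avoiding p (@card_nearer_inj z s)).
  apply: leq_sum => f _; apply: eq_leq; apply: card_avoiding_sampled.
  by rewrite !inE (negbTE h0z).
by rewrite leq_add.
Qed.

Lemma card_sampled h0 : q * #|[set c : colouring | h0 \in sample c]| = q ^ #|E|.
Proof.
have := @card_avoiding_sampled E p finset.set0 h0; rewrite inE => /(_ isT).
rewrite card_avoiding cards0 mul1n subn0 => <-; congr (_ * _); apply: eq_card => c.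
rewrite [LHS]inE [RHS]inE; suff -> : c \in avoiding p finset.set0 by [].
by apply/avoidingP => h; rewrite inE.
Qed.

(** Union bound: an edge is spoiled only by itself or by one of the edges that it meets. *)
Lemma sum_not_good : q * \sum_(c : colouring) #|[set f | ~~ goodI c f]| <=
  (#|E| + \sum_f #|[set h | mt f h]|) * q ^ #|E|.
Proof.
rewrite [X in q * X]card_set_exchange big_distrr /=.
have -> : (#|E| + \sum_f #|[set h | mt f h]|) * q ^ #|E| =
    \sum_f (1 + #|[set h | mt f h]|) * q ^ #|E|.
  by rewrite -big_distrl big_split /= sum1_card.
apply: leq_sum => f _; pose J := f |: [set h | mt f h].
apply: leq_trans (_ : #|J| * q ^ #|E| <= _); last first.
  by rewrite leq_mul2r cardsU1 leq_add2r leq_b1 orbT.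
rewrite -sum_nat_const -(eq_bigr _ (fun h _ => card_sampled h)) -big_distrr /=.
rewrite leq_mul2l; apply/orP; right.
apply: leq_trans (_ : #|\bigcup_(h in J) [set c : colouring | h \in sample c]| <= _).
  apply: subset_leq_card; apply/fintype.subsetP => c; rewrite inE negb_and.
  case/orP => [/negPn fc|/forall_inPn[h hc /negPn m]].
    by apply/finset.bigcupP; exists f; [rewrite setU11 | rewrite inE].
  apply/finset.bigcupP; exists h; last by rewrite inE.
  by rewrite finset.in_setU1 inE m orbT.
elim/big_rec2: _ => [|h a A _ le]; first by rewrite cards0.
by apply: leq_trans (leq_card_setU _ _) _; rewrite leq_add2l.
Qed.

Lemma sum_sample : q * \sum_(c : colouring) #|sample c| = #|E| * q ^ #|E|.
Proof.
have -> : \sum_(c : colouring) #|sample c| = \sum_(c : colouring) #|[set h | h \in sample c]|.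
  by apply: eq_bigr => c _; apply: eq_card => h; rewrite !inE.
rewrite card_set_exchange big_distrr /= (eq_bigr _ (fun h _ => card_sampled h)).
by rewrite sum_nat_const.
Qed.

Lemma sum_vis : \sum_(c : colouring) \sum_(f | goodI c f) size (vis lf rt ab lo N (sample c) f)
  <= 2 * N * q ^ #|E|.+1.
Proof.
apply: leq_trans (_ : \sum_(c : colouring) \sum_(z < N) #|[set f | goodI c f && seesI c f z]| <= _).
  apply: leq_sum => c _; rewrite (eq_bigr (fun z : 'I_N => \sum_(f | goodI c f) seesI c f z)).
    rewrite exchange_big; apply: leq_sum => f _; rewrite /vis size_filter.
    rewrite -(big_mkord xpredT (fun z => nat_of_bool (seesI c f z))) -sum1_count big_mkcond.
    by rewrite /index_iota subn0; apply: leq_sum => z _; case: (seesI c f z).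
  move=> z _; rewrite -sum1_card big_mkcond [RHS]big_mkcond; apply: eq_bigr => f _.
  by rewrite inE; case: (goodI c f); case: (seesI c f z).
rewrite exchange_big; apply: leq_trans (_ : \sum_(z < N) 2 * q ^ #|E|.+1 <= _).
  by apply: leq_sum => z _; exact: sum_sees.
by rewrite sum_nat_const card_ord mulnCA mulnA.
Qed.

Lemma nwalls_le (I : {set E}) f : nwalls lf rt ab lo N I f <=
  \sum_(h in I) (sees lf rt ab lo I f (lf h) + sees lf rt ab lo I f (rt h)).
Proof.
rewrite /nwalls -sumn_count sumnE big_map.
apply: leq_trans (_ : \sum_(u <- iota 0 N) \sum_(h in I)
  (((u == lf h) && sees lf rt ab lo I f (lf h)) + ((u == rt h) && sees lf rt ab lo I f (rt h))) <= _).
  apply: leq_sum => u _; case: (boolP (wall _ _ _ _)) => //= /exists_inP[h hI e].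
  rewrite (bigD1 h) //=; apply: leq_trans (leq_addr _ _).
  by case/orP: e => /eqP->; rewrite eqxx /= ?leq_addr ?leq_addl.
rewrite exchange_big; apply: leq_sum => h hI; rewrite big_split /=; apply: leq_add.
  exact/sum_eq_and/iota_uniq.
exact/sum_eq_and/iota_uniq.
Qed.

(** Each edge, when sampled, offers two ends, and each end costs 2 in expectation. The resulting
    average of 4 visible sampled ends per edge does not depend on [q], which is why the codes have
    bounded length. *)
Lemma sum_nwalls : \sum_(c : colouring) \sum_(f | goodI c f) nwalls lf rt ab lo N (sample c) f
  <= 4 * #|E| * q ^ #|E|.
Proof.
apply: leq_trans (_ : \sum_(h : E) \sum_(c : colouring)
   (#|[set f | [&& h \in sample c, goodI c f & seesI c f (lf h)]]| +
    #|[set f | [&& h \in sample c, goodI c f & seesI c f (rt h)]]|) <= _).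
  rewrite exchange_big; apply: leq_sum => c _.
  apply: leq_trans (_ : \sum_(f | goodI c f) \sum_(h in sample c)
    (seesI c f (lf h) + seesI c f (rt h)) <= _).
    by apply: leq_sum => f _; exact: nwalls_le.
  rewrite exchange_big /= [X in X <= _]big_mkcond; apply: leq_sum => h _.
  case: ifP => // _; rewrite big_split /=; apply: leq_add; apply: eq_leq.
    rewrite -[RHS]sum1_card big_mkcond [RHS]big_mkcond; apply: eq_bigr => f _.
    by rewrite finset.in_set; case: (goodI c f) => //=; case: (seesI c f _).
  rewrite -[RHS]sum1_card big_mkcond [RHS]big_mkcond; apply: eq_bigr => f _.
  by rewrite finset.in_set; case: (goodI c f) => //=; case: (seesI c f _).
apply: leq_trans (_ : \sum_(h : E) 4 * q ^ #|E| <= _); last first.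
  by rewrite sum_nat_const mulnCA mulnA.
apply: leq_sum => h _; rewrite big_split /=.
rewrite (_ : 4 * _ = 2 * q ^ #|E| + 2 * q ^ #|E|); last by rewrite -mulnDl.
by apply: leq_add; apply: sum_sees_sampled; rewrite /passes ltnn ?andbF.
Qed.

End Sampling.

(** * Counting crossings *)

Section DoubleCount.
Variables (E : finType) (lf rt : E -> nat) (ab : E -> nat -> bool) (mt lo : rel E).
Variables (N D : nat).
Hypothesis lay : layered lf rt ab mt lo.
Hypothesis mt_sym : symmetric mt.
Hypothesis rtN : forall e, rt e < N.
Hypothesis nonhom : separated lf rt ab (iota 0 N) [set: E].
Hypothesis HD : local_bound lf rt ab D.
Variable I : {set E}.
Local Notation seesI := (sees lf rt ab lo I).
Local Notation visI := (vis lf rt ab lo N I).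
Local Notation tameI := (tame lf rt ab mt lo N I).
Variable rs : E -> nat.
Hypothesis rs_lo : forall f h, lf f = lf h -> f != h -> ~~ mt f h ->
  (rs h < rs f) = lo h f.

Lemma size_visE f : size (visI f) = \sum_(z < N) seesI f z.
Proof.
rewrite size_filter -(big_mkord xpredT (fun z => nat_of_bool (seesI f z))) -sum1_count.
by rewrite [LHS]big_mkcond /index_iota subn0; apply: eq_bigr => z _; case: (seesI f z).
Qed.

(** Every edge is charged once to each vertex that it sees and once to its left end. There are
    [2 * N] vertices with a side, and [N + #|I|] slots between the sampled edges at their left
    ends. *)
Lemma sum_vis_tame B m : \sum_(f in tameI B m) (size (visI f)).+1 <=
  (3 * N + #|I|) * (ncodes B ^ 2 * (3 * (2 * m + 3)) ^ D).
Proof.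
set b := ncodes B ^ 2 * _.
have bP z (s : bool) : z <= N -> #|[set f in tameI B m | seesI f z && (ab f z == s)]| <= b.
  by move=> zN; rewrite /b -mulnn -mulnA; exact: (pass_anchor lay mt_sym rtN nonhom HD).
have K1 : 0 < ncodes B by rewrite /ncodes muln_gt0 expn_gt0.
have bS z c : #|[set f in tameI B m | (lf f == z) && (#|wedge lf lo I f| == c)]| <= b.
  apply: leq_trans (start_anchor lay mt_sym rtN nonhom HD I rs_lo B m z c) _.
  by rewrite /b leq_mul2r leq_pmulr ?orbT // leq_pmull.
have -> : 3 * N + #|I| = 2 * N + (N + #|I|) by lia.
rewrite mulnDl (eq_bigr (fun f => size (visI f) + 1)) => [|f _]; last by rewrite addn1.
rewrite big_split /=; apply: leq_add.
  rewrite (eq_bigr (fun f => \sum_(z < N) seesI f z)) => [|f _]; last exact: size_visE.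
  rewrite exchange_big /=.
  apply: leq_trans (_ : \sum_(z < N) 2 * b <= _); last by rewrite sum_nat_const card_ord mulnCA mulnA.
  apply: leq_sum => z _.
  apply: leq_trans (_ : \sum_(s : bool) #|[set f in tameI B m | seesI f z && (ab f z == s)]| <= _).
    rewrite [X in _ <= X](eq_bigr (fun s : bool => \sum_(f in tameI B m) (seesI f z && (ab f z == s)))).
      rewrite exchange_big /=; apply: leq_sum => f _; rewrite big_bool /=.
      by case: (seesI f z) => //; case: (ab f z).
    move=> s _; rewrite -sum1_card big_mkcond [RHS]big_mkcond; apply: eq_bigr => f _.
    by rewrite finset.in_set; case: (f \in _) => //=; case: (_ && _).
  rewrite big_bool mul2n -addnn; apply: leq_add; apply: bP; exact: ltnW.
pose Iz (z : nat) := [set h in I | lf h == z].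
apply: leq_trans (_ : \sum_(z < N) \sum_(c < #|Iz z|.+1)
    #|[set f in tameI B m | (lf f == z) && (#|wedge lf lo I f| == c)]| <= _).
  rewrite [X in _ <= X](eq_bigr (fun z : 'I_N => \sum_(c < #|Iz z|.+1) \sum_(f in tameI B m)
     ((lf f == z) && (#|wedge lf lo I f| == c)))); last first.
    move=> z _; apply: eq_bigr => c _.
    rewrite -sum1_card big_mkcond [RHS]big_mkcond; apply: eq_bigr => f _.
    by rewrite finset.in_set; case: (f \in _) => //=; case: (_ && _).
  rewrite (eq_bigr (fun z : 'I_N => \sum_(f in tameI B m) \sum_(c < #|Iz z|.+1)
     ((lf f == z) && (#|wedge lf lo I f| == c)))); last first.
    by move=> z _; rewrite exchange_big.
  rewrite exchange_big /=; apply: leq_sum => f _.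
  have zN : lf f < N by apply: ltn_trans (rtN f); exact: (lf_lt_rt lay).
  have cI : #|wedge lf lo I f| < #|Iz (lf f)|.+1.
    rewrite ltnS; apply: subset_leq_card; apply/fintype.subsetP => h.
    by rewrite !inE => /and3P[-> ->].
  rewrite (bigD1 (Ordinal zN)) //= (bigD1 (Ordinal cI)) //= !eqxx /=.
  by rewrite -addnA leq_addr.
apply: leq_trans (_ : \sum_(z < N) (#|Iz z|.+1 * b) <= _).
  apply: leq_sum => z _; rewrite -[X in X * b]card_ord -sum_nat_const.
  by apply: leq_sum => c _; exact: bS.
rewrite -big_distrl leq_mul2r; apply/orP; right; rewrite /= (eq_bigr (fun z : 'I_N => 1 + #|Iz z|)) //.
rewrite big_split /= sum1_card card_ord leq_add2l.
rewrite -[X in _ <= X]sum1_card (partition_big (fun h => inord (lf h) : 'I_N.+1) predT) //=.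
rewrite big_ord_recr /=; apply: leq_trans (leq_addr _ _); apply: leq_sum => z _.
rewrite -sum1_card; apply: eq_leq; apply: eq_bigl => h; rewrite !inE.
have hN : lf h < N by apply: ltn_trans (rtN h); exact: (lf_lt_rt lay).
by rewrite -val_eqE /= inordK // ltnW.
Qed.

(** Edges seeing between [x] and [2x - 2] vertices are counted at least [x] times in [sum_vis_tame],
    which turns [x^D] into [x^d]; as [d > 0], the dyadic scales add up geometrically. The 15 comes
    from [3 (2 (2x - 1) + 3) <= 15 x]. *)
Lemma card_tame_dyadic B d i : D = d.+1 -> 0 < d ->
  #|tameI B (2 ^ i - 1)| <=
    2 * (3 * N + #|I|) * (ncodes B ^ 2 * 15 ^ D) * (2 ^ i) ^ d.
Proof.
move=> eD d0; set A := 3 * N + #|I|; set Q := ncodes B ^ 2 * 15 ^ D.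
have pw x y : x <= y -> x ^ D <= y ^ D by move=> xy; rewrite eD leq_exp2r.
elim: i => [|i IH].
  have := sum_vis_tame B 0; rewrite muln0 /= -/A => h.
  rewrite expn0 subnn exp1n muln1; apply: leq_trans (_ : A * (ncodes B ^ 2 * 9 ^ D) <= _).
    apply: leq_trans h; rewrite -sum1_card; exact: leq_sum.
  apply: leq_trans (_ : A * Q <= _); last by rewrite -mulnA leq_pmull.
  by rewrite leq_mul2l /Q leq_mul2l pw ?orbT.
have hx := expn_gt0 2 i; rewrite orTb in hx.
move: IH; rewrite expnS; set x := 2 ^ i => IH; rewrite -/x in hx.
have := sum_vis_tame B (2 * x - 1); rewrite -/A => h.
have {}h : x * (#|tameI B (2 * x - 1)| - #|tameI B (x - 1)|) <= A * Q * x ^ D.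
  apply: leq_trans (_ : A * (ncodes B ^ 2 * (15 * x) ^ D) <= _); last first.
    by rewrite expnMn /Q !mulnA.
  apply: leq_trans (_ : A * (ncodes B ^ 2 * (3 * (2 * (2 * x - 1) + 3)) ^ D) <= _); last first.
    by rewrite leq_mul2l leq_mul2l pw ?orbT //; move: hx; clear; lia.
  apply: leq_trans h.
  have sub : tameI B (x - 1) \subset tameI B (2 * x - 1).
    apply/fintype.subsetP => f; rewrite !inE => /and3P[-> -> /leq_trans]; apply.
    by move: hx; clear; lia.
  rewrite -(cardsDS sub) mulnC -sum_nat_const.
  apply: leq_trans (_ : \sum_(f in tameI B (2 * x - 1) :\: tameI B (x - 1)) (size (visI f)).+1 <= _).
    apply: leq_sum => f; rewrite finset.in_setD => /andP[h1 h2].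
    move: h1 h2; rewrite !inE => h1 /and3P[g w v]; move: h1; rewrite g w /= -ltnNge.
    by move: hx; clear; lia.
  by rewrite [X in _ <= X](big_setID (tameI B (x - 1))) /= (finset.setIidPr sub) leq_addl.
have {}h : #|tameI B (2 * x - 1)| - #|tameI B (x - 1)| <= A * Q * x ^ d.
  by rewrite -(leq_pmul2l hx); apply: leq_trans h _; rewrite eD expnS mulnCA.
have h2 : 2 * x ^ d <= (2 * x) ^ d.
  by rewrite expnMn leq_mul // -[X in X <= _]expn1 leq_exp2l.
have h3 : 2 * A * Q * (2 * x ^ d) <= 2 * A * Q * (2 * x) ^ d by rewrite leq_mul2l h2 orbT.
have e2 : 2 * A * Q * (2 * x ^ d) = 4 * (A * Q * x ^ d) by move: (x ^ d); clear; lia.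
have e1 : 2 * A * Q * x ^ d = 2 * (A * Q * x ^ d) by move: (x ^ d); clear; lia.
by apply: leq_trans h3; move: IH h; rewrite e2 e1; clear; lia.
Qed.

End DoubleCount.

(** * Choice of a sample and of the scale of visibility *)

(** The ratio 5 lets four averages be controlled by one colouring, since [4/5 < 1]. *)
Lemma markov5 (T : finType) (A : T -> nat) e :
  \sum_c A c <= e * #|T| -> 5 * #|[set c | 5 * e < A c]| <= #|T|.
Proof.
move=> h; have h2 : #|[set c | 5 * e < A c]| * (5 * e).+1 <= e * #|T|.
  apply: leq_trans h; rewrite -sum_nat_const [X in _ <= X](bigID (mem [set c | 5 * e < A c])) /=.
  by apply: leq_trans (leq_addr _ _); apply: leq_sum => c; rewrite inE.
by move: h2; clear; nia.
Qed.

(* [rk z s] orders the edges passing [z] on side [s] by their distance from [z],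
   and [rs] those starting at a common vertex from bottom to top. *)
Record ranked (E : finType) (lf rt : E -> nat) (ab : E -> nat -> bool)
    (mt lo : rel E) (rk : nat -> bool -> E -> nat) (rs : E -> nat) : Prop := Ranked {
  rk_inj : forall z s, {in side lf rt ab z s &, injective (rk z s)};
  rk_lo : forall z s f h, f \in side lf rt ab z s -> h \in side lf rt ab z s ->
    ~~ mt f h -> rk z s h < rk z s f -> if s then lo h f else lo f h;
  rs_lo : forall f h, lf f = lf h -> f != h -> ~~ mt f h -> (rs h < rs f) = lo h f
}.

Lemma exists_pow2 a b : 0 < b -> exists i, a <= 2 ^ i * b /\
  (i = 0 \/ 2 ^ i * b < 2 * a).
Proof.
move=> b0; have ex : exists i, a <= 2 ^ i * b.
  exists a; apply: leq_trans (leq_pmulr _ b0); exact: ltnW (ltn_expl _ _).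
case: (ex_minnP ex) => i hi mi; exists i; split=> //.
case: i hi mi => [|i] hi mi; first by left.
right; have := contraFN (mi i) (ltnn i); rewrite -ltnNge => h.
by rewrite expnS -mulnA ltn_mul2l.
Qed.

(* [B] bounds the number of sampled ends that an edge may see. *)
Definition Qconst (B d : nat) := ncodes B ^ 2 * 15 ^ d.+1.
Definition Kconst (B d : nat) :=
  3212 * Qconst B d * 160 ^ d * (4 * (24 * Qconst B d + 21) + 40) ^ d.

Section CrossingCount.
Variables (E : finType) (lf rt : E -> nat) (ab : E -> nat -> bool) (mt lo : rel E).
Variables (N B d X : nat) (rk : nat -> bool -> E -> nat) (rs : E -> nat).
Hypothesis lay : layered lf rt ab mt lo.
Hypothesis mt_sym : symmetric mt.
Hypothesis rtN : forall e, rt e < N.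
Hypothesis nonhom : separated lf rt ab (iota 0 N) [set: E].
Hypothesis HD : local_bound lf rt ab d.+1.
Hypothesis ran : ranked lf rt ab mt lo rk rs.
Hypothesis degX : \sum_f #|[set h | mt f h]| <= 2 * X.
Hypothesis d0 : 0 < d.
Hypothesis B160 : 160 <= B.

Lemma good_sample p : exists I : {set E},
  [/\ p.+1 * #|[set f | ~~ good mt I f]| <= 5 * (#|E| + 2 * X),
      \sum_(f | good mt I f) size (vis lf rt ab lo N I f) <= 5 * (2 * N * p.+1),
      \sum_(f | good mt I f) nwalls lf rt ab lo N I f <= 5 * (4 * #|E|) &
      p.+1 * #|I| <= 5 * #|E|].
Proof.
pose T := {ffun E -> 'I_p.+1}.
have cT : #|{: T}| = p.+1 ^ #|E| by rewrite card_ffun card_ord.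
pose A1 (c : T) := p.+1 * #|[set f | ~~ good mt (sample c) f]|.
pose A2 (c : T) := \sum_(f | good mt (sample c) f) size (vis lf rt ab lo N (sample c) f).
pose A3 (c : T) := \sum_(f | good mt (sample c) f) nwalls lf rt ab lo N (sample c) f.
pose A4 (c : T) := p.+1 * #|sample c|.
have h1 : \sum_c A1 c <= (#|E| + 2 * X) * #|{: T}|.
  rewrite /A1 -big_distrr cT /=; apply: leq_trans (sum_not_good mt p) _.
  by rewrite leq_mul2r leq_add2l degX orbT.
have h2 : \sum_c A2 c <= (2 * N * p.+1) * #|{: T}|.
  by rewrite cT -mulnA -expnS; exact: (sum_vis N p (rk_inj ran) (rk_lo ran)).
have h3 : \sum_c A3 c <= (4 * #|E|) * #|{: T}|.
  by rewrite cT; exact: (sum_nwalls N p (rk_inj ran) (rk_lo ran)).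
have h4 : \sum_c A4 c <= #|E| * #|{: T}|.
  by rewrite cT /A4 -big_distrr /= sum_sample.
move/markov5: h1; set B1 := [set c | _] => h1.
move/markov5: h2; set B2 := [set c | _] => h2.
move/markov5: h3; set B3 := [set c | _] => h3.
move/markov5: h4; set B4 := [set c | _] => h4.
have T0 : 0 < #|{: T}| by rewrite cT expn_gt0.
have lt : #|B1 :|: B2 :|: B3 :|: B4| < #|{: T}|.
  have u1 := (leq_card_setU (B1 :|: B2 :|: B3) B4).1.
  have u2 := (leq_card_setU (B1 :|: B2) B3).1.
  have u3 := (leq_card_setU B1 B2).1.
  have ar t a1 a2 a3 a4 a5 a6 a7 : 5 * a1 <= t -> 5 * a2 <= t -> 5 * a3 <= t ->
      5 * a4 <= t -> 0 < t -> a5 <= a1 + a2 -> a6 <= a5 + a3 -> a7 <= a6 + a4 -> a7 < t.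
    by clear; lia.
  exact: ar h1 h2 h3 h4 T0 u3 u2 u1.
have [c] : exists c, c \notin B1 :|: B2 :|: B3 :|: B4.
  apply/existsP; rewrite -negb_forall; apply/negP => /forallP h.
  by move: lt; rewrite ltnNge -cardsT subset_leq_card //; apply/fintype.subsetP => c _.
rewrite !finset.in_setU !negb_or !finset.in_set -!leqNgt => /andP[/andP[/andP[b1 b2] b3] b4].
by exists (sample c); split.
Qed.

Theorem crossing_count : #|E| <= 4 * X ->
  #|E| ^ (2 * d).+1 <= Kconst B d * N ^ d.+1 * X ^ d.
Proof.
move=> MX; case: (posnP #|E|) => [->|M0]; first by rewrite exp0n.
(* The last two summands give [q M >= 20 (M + 2X)], so at most [M/4] edges are not good; the summand
   [24 * Q] is reserved for excluding the scale [Y = 1]. *)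
pose Q := Qconst B d; pose p := 24 * Q + 20 + (40 * X) %/ #|E|.
have [I [g1 g2 g3 g4]] := good_sample p.
(* The good edges see at most [10 N q] vertices in total, so with [Y M >= 80 N q] at most [M/8] of
   them see [Y] vertices or more. *)
have [i [Yge Yi]] := exists_pow2 (80 * N * p.+1) M0.
set Y := 2 ^ i in Yge Yi; set M := #|E| in MX M0 g1 g2 g3 g4 Yge Yi *.
have Y0 : 0 < Y by rewrite expn_gt0.
have tameM : M <= 2 * #|tame lf rt ab mt lo N I B (Y - 1)|.
  pose n1 := [set f | ~~ good mt I f].
  pose n2 := [set f | good mt I f && (B < nwalls lf rt ab lo N I f)].
  pose n3 := [set f | good mt I f && (Y - 1 < size (vis lf rt ab lo N I f))].
  have c1 : 4 * #|n1| <= M.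
    have dv := divn_eq (40 * X) M; have lm := ltn_pmod (40 * X) M0.
    have le : 20 * (M + 2 * X) <= p.+1 * M.
      by rewrite /p; move: dv lm; clear; nia.
    rewrite -(leq_pmul2l (ltn0Sn p)); move: g1 le; rewrite -/n1; clear; lia.
  (* The visible sampled ends number at most [20 M], and [160 = 8 * 20]. *)
  have c2 : 8 * #|n2| <= M.
    have : #|n2| * B.+1 <= 5 * (4 * M); last by move: B160; clear; nia.
    apply: leq_trans g3; rewrite -sum_nat_const.
    rewrite [X in _ <= X](bigID (mem n2)) /=; apply: leq_trans (leq_addr _ _).
    rewrite [X in _ <= X](eq_bigl (mem n2)); last first.
      by move=> f; rewrite /= inE; case: (good _ _ _).
    by apply: leq_sum => f; rewrite inE => /andP[].
  have c3 : 8 * #|n3| <= M.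
    have h : #|n3| * Y <= 5 * (2 * N * p.+1).
      apply: leq_trans g2; rewrite -sum_nat_const.
      rewrite [X in _ <= X](bigID (mem n3)) /=; apply: leq_trans (leq_addr _ _).
      rewrite [X in _ <= X](eq_bigl (mem n3)); last first.
        by move=> f; rewrite /= inE; case: (good _ _ _).
      by apply: leq_sum => f; rewrite inE => /andP[_]; rewrite subn1 prednK.
    rewrite -(leq_pmul2l Y0); move: h Yge; clear; lia.
  have cov : M <= #|n1| + #|n2| + #|n3| + #|tame lf rt ab mt lo N I B (Y - 1)|.
    rewrite /M -cardsT.
    apply: leq_trans (_ : #|n1 :|: n2 :|: n3 :|: tame lf rt ab mt lo N I B (Y - 1)| <= _).
      apply: subset_leq_card; apply/fintype.subsetP => f _; rewrite !inE.
      by case: (good mt I f) => //=; case: ltnP => //=; case: ltnP.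
    apply: leq_trans (leq_card_setU _ _) _; rewrite leq_add2r.
    apply: leq_trans (leq_card_setU _ _) _; rewrite leq_add2r.
    exact: leq_card_setU.
  by move: c1 c2 c3 cov; clear; lia.
have tb : #|tame lf rt ab mt lo N I B (Y - 1)| <= 2 * (3 * N + #|I|) * Q * Y ^ d.
  exact: (card_tame_dyadic lay mt_sym rtN nonhom HD I (rs_lo ran) B i erefl d0).
have {tameM}tb : M <= 4 * (3 * N + #|I|) * Q * Y ^ d.
  apply: leq_trans tameM _; rewrite (_ : 4 * _ * Q * Y ^ d = 2 * (2 * (3 * N + #|I|) * Q * Y ^ d)).
    by rewrite leq_mul2l tb.
  by clear; lia.
have qQ : 24 * Q < p.+1 by rewrite ltnS /p -addnA leq_addr.
(* If [Y = 1] then [80 N q <= M] and [q #|I| <= 5 M], and the bound on tame edges would give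
   [q <= 24 Q], against the choice of [p]. *)
case: Yi => [i0|Yi].
  have Y1 : Y = 1 by rewrite /Y i0.
  have : p.+1 * M <= 24 * Q * M.
    apply: leq_trans (_ : p.+1 * (4 * (3 * N + #|I|) * Q) <= _).
      by rewrite leq_mul2l; move: tb; rewrite Y1 exp1n muln1 => ->; rewrite orbT.
    have : p.+1 * (4 * (3 * N + #|I|)) <= 24 * M.
      by move: Yge g4; rewrite Y1; clear; lia.
    by clear; nia.
  by rewrite leq_pmul2r // leqNgt qQ.
(* [q #|I| <= 5 M <= 5 Y M < 800 N q], so the sample has at most [800 N] edges. *)
have A803 : 3 * N + #|I| <= 803 * N.
  have MY : M <= Y * M by rewrite leq_pmull.
  have : 5 * M <= p.+1 * (800 * N).
    by move: Yi MY; move: (Y * M) (p.+1) => y q; clear; lia.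
  move=> h; have : p.+1 * #|I| <= p.+1 * (800 * N) by exact: leq_trans h.
  by rewrite leq_pmul2l // => ?; rewrite (_ : 803 * N = 3 * N + 800 * N) ?leq_add2l // -mulnDl.
have e1 : M ^ d.+1 <= 3212 * N * Q * (160 * N * p.+1) ^ d.
  rewrite expnS; apply: leq_trans (_ : 4 * (803 * N) * Q * Y ^ d * M ^ d <= _).
    by rewrite leq_mul2r; apply/orP; right; apply: leq_trans tb _; rewrite !leq_mul2r leq_mul2l A803 !orbT.
  rewrite -mulnA -expnMn; have -> : 4 * (803 * N) = 3212 * N by clear; lia.
  rewrite leq_mul2l; apply/orP; right; rewrite leq_exp2r //.
  by move: Yi; clear; lia.
(* Here [M <= 4 X] absorbs the constant part of [p], so that [q] is of order [X/M]. *)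
have qM : p.+1 * M <= (4 * (24 * Q + 21) + 40) * X.
  have := leq_trunc_div (40 * X) M; rewrite /p; move: MX; clear; nia.
have -> : (2 * d).+1 = d.+1 + d by clear; lia.
rewrite expnD; apply: leq_trans (_ : 3212 * N * Q * (160 * N * p.+1) ^ d * M ^ d <= _).
  by rewrite leq_mul2r e1 orbT.
rewrite -mulnA -expnMn (_ : 160 * N * p.+1 * M = 160 * (N * (p.+1 * M))); last by clear; lia.
apply: leq_trans (_ : 3212 * N * Q * (160 * (N * ((4 * (24 * Q + 21) + 40) * X))) ^ d <= _).
  by rewrite leq_mul2l leq_exp2r // !leq_mul2l qM !orbT.
rewrite !expnMn /Kconst -/Q expnS; apply: eq_leq.
move: (160 ^ d) (N ^ d) ((_ + 40) ^ d) (X ^ d) => a b c e; clear; lia.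
Qed.

End CrossingCount.

(** * Local bounds *)

Section EdgeWords.
Variables (E : finType) (lf rt : E -> nat) (ab : E -> nat -> bool).
Hypothesis lf_rt : forall e, lf e < rt e.

Definition letter (e : E) (u : nat) : nat :=
  if (u == lf e) || (u == rt e) then 2
  else if passes lf rt e u then (if ab e u then 3 else 1) else 0.

Definition word (zs : seq nat) (e : E) := map (letter e) zs.

Lemma word_valid2 zs e : all (fun u => u < lf e) zs -> valid2 (word zs e).
Proof.
elim: zs => //= u zs IH /andP[ul hz]; rewrite IH // andbT /letter /passes.
move: (lf_rt e) ul; clear; case: ifP => [|_]; first by lia.
by case: ifP => //; lia.
Qed.

Lemma word_valid1 zs e : path.sorted gtn zs -> all (fun u => u < rt e) zs ->
  lf e \in zs -> valid1 (word zs e).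
Proof.
elim: zs => //= u zs IH pz /andP[ur hz]; rewrite inE => hl.
have hzu : all (fun x => x < u) zs.
  by move: pz; rewrite path_sortedE; [case/andP|exact: rev_trans ltn_trans].
case: (eqVneq (lf e) u) hl => [eu _|neq /= hl].
  by rewrite /letter eu eqxx /= word_valid2 // eu.
rewrite IH ?(path_sorted pz) // andbT; apply/orP; right.
have lu : lf e < u by move/allP: hzu => /(_ _ hl).
by rewrite /letter /passes lu ur (gtn_eqF lu) (ltn_eqF ur) /=; case: (ab e u).
Qed.

Lemma word_valid0 zs e : path.sorted gtn zs -> lf e \in zs -> rt e \in zs ->
  valid0 (word zs e).
Proof.
elim: zs => //= u zs IH pz; rewrite !inE => hl hr.
have hzu : all (fun x => x < u) zs.
  by move: pz; rewrite path_sortedE; [case/andP|exact: rev_trans ltn_trans].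
case: (eqVneq (rt e) u) hr => [eu _|neq /= hr].
  apply/orP; right; rewrite /letter eu eqxx orbT /=.
  apply: word_valid1; rewrite ?(path_sorted pz) ?eu //.
  by move: hl; rewrite -eu ltn_eqF.
have ru : rt e < u by move/allP: hzu => /(_ _ hr).
have lu := ltn_trans (lf_rt e) ru.
rewrite IH ?(path_sorted pz) //; last by move: hl; rewrite ltn_eqF.
by rewrite /letter /passes (gtn_eqF lu) (gtn_eqF ru) [u < _]ltnNge (ltnW ru) andbF.
Qed.

(** The letters 2 locate the ends and the letters 1 and 3 record the sides, so separated edges have
    distinct words. *)
Lemma word_bound (G : {set E}) (Z : seq nat) j : uniq Z ->
  (forall f, f \in G -> lf f \in Z /\ rt f \in Z) -> separated lf rt ab Z G ->
  (forall f g b, f \in G -> g \in G -> f != g ->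
     ~~ altn b j.+2 (word (sort geq Z) f) (word (sort geq Z) g)) ->
  #|G| <= (3 * size Z) ^ j.+1.
Proof.
move=> uZ ends sep free; set zs := sort geq Z in free.
have sz : path.sorted gtn zs.
  have : path.sorted geq zs by apply: sort_sorted => x y; exact: leq_total.
  have : uniq zs by rewrite sort_uniq.
  elim: zs {free} => //= u [|v zs] //= IH /andP[/norP[nuv hu] uv] /andP[vu pz].
  by rewrite IH // andbT ltn_neqAle eq_sym nuv.
have mz u : (u \in zs) = (u \in Z) by rewrite mem_sort.
have inj : {in G &, injective (word zs)}.
  move=> f g fG gG e; apply/eqP/negPn/negP => nfg.
  have el u : u \in Z -> letter f u = letter g u.
    by move=> uZ'; move/eq_in_map: e => -> //; rewrite mz.
  have l2 f' u : letter f' u = 2 -> u = lf f' \/ u = rt f'.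
    rewrite /letter; case: ifP => [/orP[/eqP->|/eqP->]|_]; [by left|by right|].
    by case: ifP => // _; case: ifP.
  have ll f' : letter f' (lf f') = 2 by rewrite /letter eqxx.
  have lr f' : letter f' (rt f') = 2 by rewrite /letter eqxx orbT.
  have [flZ frZ] := ends _ fG; have [glZ grZ] := ends _ gG.
  have a1 := l2 g _ (etrans (esym (el _ flZ)) (ll f)).
  have a2 := l2 g _ (etrans (esym (el _ frZ)) (lr f)).
  have elf : lf f = lf g.
    by move: a1 a2 (lf_rt f) (lf_rt g); clear; lia.
  have ert : rt f = rt g.
    by move: a1 a2 (lf_rt f) (lf_rt g); clear; lia.
  have [u uZ' [pf dab]] := sep _ _ fG gG nfg elf ert; apply: dab.
  have pg : passes lf rt g u by rewrite /passes -elf -ert.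
  have := el u uZ'; rewrite /letter -elf -ert pf -{2}/(passes lf rt f u).
  have /andP[h1 h2] := pf; rewrite gtn_eqF //= ltn_eqF //.
  by rewrite /passes -elf -ert h1 h2; case: (ab f u); case: (ab g u).
have -> : #|G| = size (map (word zs) (enum G)) by rewrite size_map cardE.
apply: leq_trans (words_bound (n := size Z) _ _ _) _ => //.
- by rewrite map_inj_in_uniq ?enum_uniq // => f g; rewrite !mem_enum; exact: inj.
- move=> _ /mapP[f + ->]; rewrite mem_enum => fG; have [h1 h2] := ends _ fG.
  by rewrite word_valid0 ?mz //= size_map size_sort.
- move=> _ _ /mapP[f + ->] /mapP[g + ->]; rewrite !mem_enum => fG gG neq b.
  by apply: free => //; apply: contraNneq neq => ->.
Qed.

Variable cr : E -> E -> nat.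
Hypothesis alt_cr : forall zs f g b j, path.sorted geq zs -> f != g ->
  altn b j.+1 (word zs f) (word zs g) -> j <= cr f g.

Lemma bound_all k (Z : seq nat) (G : {set E}) : uniq Z ->
  (forall f, f \in G -> lf f \in Z /\ rt f \in Z) -> separated lf rt ab Z G ->
  (forall f g, f \in G -> g \in G -> f != g -> cr f g <= k) ->
  #|G| <= (3 * size Z) ^ k.+1.
Proof.
move=> uZ ends sep h; apply: word_bound => // f g b fG gG neq; apply/negP => /alt_cr.
have sz : path.sorted geq (sort geq Z) by apply: sort_sorted => x y; exact: leq_total.
by move=> /(_ sz neq); rewrite ltnNge h.
Qed.

Lemma separated_sub (Z : seq nat) (G H : {set E}) : H \subset G ->
  separated lf rt ab Z G -> separated lf rt ab Z H.
Proof. by move=> /fintype.subsetP s h f g fH gH; apply: h; exact: s. Qed.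

(** Fixing an end costs one more exponent. Edges with a common left end are incident, and edges with
    both ends in common are parallel: hence [k+2] and [k+3]. *)
Lemma bound_by_end (en : E -> nat) j (Z : seq nat) (G : {set E}) :
  (forall f, f \in G -> en f \in Z) ->
  (forall v, #|[set f in G | en f == v]| <= (3 * size Z) ^ j) ->
  #|G| <= (3 * size Z) ^ j.+1.
Proof.
move=> hen hv; case: (set_0Vmem G) => [->|[f0 /hen f0Z]]; first by rewrite cards0.
have : 0 < size Z by case: (Z) f0Z.
case eZ : (size Z) => [//|n] _; rewrite -eZ.
apply: leq_trans (_ : #|'I_n.+1| * (3 * size Z) ^ j <= _); last first.
  by rewrite card_ord expnS -eZ leq_mul2r leq_pmull ?orbT.
apply: (card_fibres (c := fun f => inord (index (en f) Z) : 'I_n.+1)) => y.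
apply: leq_trans (hv (nth 0 Z y)); apply: subset_leq_card; apply/fintype.subsetP => f.
rewrite !inE => /andP[fG /eqP ey]; rewrite fG -ey inordK ?nth_index ?hen ?eqxx //.
by rewrite -eZ index_mem hen.
Qed.

Lemma local_bound_all k : (forall f g, f != g -> cr f g <= k) ->
  local_bound lf rt ab k.+1.
Proof. by move=> h Z G uZ ends sep; apply: bound_all => // f g _ _; exact: h. Qed.

Lemma local_bound_star k : (forall f g, f != g -> lf f = lf g -> cr f g <= k) ->
  local_bound lf rt ab k.+2.
Proof.
move=> h Z G uZ ends sep; apply: (bound_by_end (en := lf)) => [f /ends[]|v] //.
apply: bound_all => //.
- by move=> f; rewrite inE => /andP[/ends].
- by apply: separated_sub sep; apply/fintype.subsetP => f; rewrite inE => /andP[].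
- by move=> f g; rewrite !inE => /andP[_ /eqP e1] /andP[_ /eqP e2] neq; apply: h; rewrite ?e1.
Qed.

Lemma local_bound_parallel k :
  (forall f g, f != g -> lf f = lf g -> rt f = rt g -> cr f g <= k) ->
  local_bound lf rt ab k.+3.
Proof.
move=> h Z G uZ ends sep; apply: (bound_by_end (en := lf)) => [f /ends[]|v] //.
apply: (bound_by_end (en := rt)) => [f|w]; first by rewrite inE => /andP[/ends[]].
apply: bound_all => //.
- by move=> f; rewrite !inE => /andP[/andP[/ends]].
- by apply: separated_sub sep; apply/fintype.subsetP => f; rewrite !inE => /andP[/andP[]].
- move=> f g; rewrite !inE => /andP[/andP[_ /eqP e1] /eqP e3] /andP[/andP[_ /eqP e2] /eqP e4] neq.
  by apply: h; rewrite ?e1 ?e3.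
Qed.

End EdgeWords.

(** Each edge that meets a later one is charged to such a pair. The remaining edges do not meet each
    other, so their words never alternate twice and the exponent is 1. *)
Lemma planar_bound (E : finType) (lf rt : E -> nat) (ab : E -> nat -> bool)
    (mt : rel E) (N : nat) :
  (forall e, lf e < rt e) -> (forall e, rt e < N) ->
  separated lf rt ab (iota 0 N) [set: E] -> irreflexive mt -> symmetric mt ->
  (forall zs f g b, path.sorted geq zs -> f != g ->
     altn b 2 (word lf rt ab zs f) (word lf rt ab zs g) -> mt f g) ->
  2 * #|E| <= 6 * N + \sum_f #|[set h | mt f h]|.
Proof.
move=> lr rN sep irr sym alt.
pose later f := [set h | mt f h & (enum_rank f < enum_rank h)].
pose G := [set f | later f == finset.set0].
have hG : #|G| <= 3 * N.
  rewrite -[X in _ <= X]expn1 -{1}(size_iota 0 N).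
  apply: (word_bound (lf := lf) (rt := rt) (ab := ab)) => //; first exact: iota_uniq.
  - by move=> f _; rewrite !mem_iota /= !add0n rN (ltn_trans _ (rN f)).
  - apply: separated_sub sep; exact: finset.subsetT.
  - move=> f g b; rewrite !inE => /eqP fG /eqP gG neq; apply/negP => /alt m.
    have {}m : mt f g by apply: m => //; apply: sort_sorted => x y; exact: leq_total.
    case: (ltngtP (enum_rank f) (enum_rank g)) => h.
    + by move/setP: fG => /(_ g); rewrite !inE m h.
    + by move/setP: gG => /(_ f); rewrite !inE sym m h.
    + by case/eqP: neq; apply: enum_rank_inj; apply: val_inj.
have hc : #|E| <= #|G| + \sum_f #|later f|.
  rewrite -cardsT -(cardsID G) finset.setTI leq_add2l.
  rewrite -sum1_card [X in _ <= X](bigID (mem ([set: E] :\: G))) /=.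
  apply: leq_trans (leq_addr _ _); apply: leq_sum => f.
  by rewrite !inE andbT -cards_eq0 lt0n.
have hs : \sum_f #|[set h | mt f h]| = 2 * \sum_f #|later f|.
  rewrite mul2n -addnn.
  have e2 : \sum_f #|later f| = \sum_f #|[set h | mt f h & (enum_rank h < enum_rank f)]|.
    rewrite /later card_set_exchange; apply: eq_bigr => f _; apply: eq_card => h.
    by rewrite !inE sym.
  rewrite {2}e2 -big_split; apply: eq_bigr => f _ /=.
  rewrite -(cardsID [set h | enum_rank f < enum_rank h]); congr (_ + _); apply: eq_card => h.
    by rewrite !inE.
  rewrite !inE andbC -leqNgt; case: (boolP (mt f h)) => //= m.
  rewrite leq_eqVlt orb_idl // => /eqP e.
  by move: m; rewrite (enum_rank_inj (val_inj e)) irr.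
by rewrite hs; move: hG hc; clear; lia.
Qed.

Local Open Scope classical_set_scope.
Local Open Scope ring_scope.

(** * Monotone curves *)

Lemma within_comp (T U W : topologicalType) (A : set T) (B : set U)
    (f : T -> U) (g : U -> W) :
  {within A, continuous f} -> (forall x, A x -> B (f x)) ->
  {within B, continuous g} -> {within A, continuous (g \o f)}.
Proof.
move=> /subspace_continuousP cf fAB /subspace_continuousP cg.
apply/subspace_continuousP => x Ax V /= nV.
have := cg _ (fAB _ Ax) _ nV; rewrite /= nbhs_simpl => h.
have := cf _ Ax _ h; rewrite !nbhs_simpl /within /= => h2.
near=> t => At; have : A t -> B (f t) -> V (g (f t)) by near: t.
by apply=> //; exact: fAB.
Unshelve. all: by end_near. Qed.

Lemma within_compT (T U W : topologicalType) (A : set T) (f : T -> U) (g : U -> W) :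
  {within A, continuous f} -> continuous g -> {within A, continuous (g \o f)}.
Proof.
move=> cf cg; apply: (within_comp (B := setT)) cf _ _ => //.
exact: continuous_subspaceT.
Qed.

Lemma within_pair (T U W : topologicalType) (A : set T) (f : T -> U) (g : T -> W) :
  {within A, continuous f} -> {within A, continuous g} ->
  {within A, continuous (fun x => (f x, g x))}.
Proof.
move=> /subspace_continuousP cf /subspace_continuousP cg.
by apply/subspace_continuousP => x Ax; apply: cvg_pair; [exact: cf|exact: cg].
Qed.

Section Curve.
Variables (R : realType).
Implicit Types (a b x y s t v : R).

Lemma finite_avoid (A : set R) a b : finite_set A -> a < b ->
  exists v, a < v < b /\ ~ A v.
Proof.
move=> /finite_seqP[r ->]; elim: r a b => [|x r IH] a b ab.
  by exists ((a + b) / 2); split=> //; apply/andP; split; lra.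
have [v [/andP[av vb] vr]] := IH a b ab.
case: (eqVneq v x) => [vx|vx].
  have [v' [/andP[av' v'v] v'r]] := IH a v av; exists v'; split.
    by rewrite av' (lt_trans v'v).
  rewrite /= inE => /orP[/eqP e|]; last exact: v'r.
  by move: v'v; rewrite e vx ltxx.
exists v; split; first by rewrite av.
by rewrite /= inE (negbTE vx).
Qed.

Lemma ivt_open (f : R -> R) a b v : a < b -> {within `[a, b], continuous f} ->
  f a < v < f b \/ f b < v < f a -> exists2 c, a < c < b & f c = v.
Proof.
move=> ab cf h.
have [|c] := @IVT R f a b v (ltW ab) cf.
  rewrite ge_min le_max; case: h => /andP[h1 h2]; apply/andP; split; apply/orP.
  - by left; exact: ltW.
  - by right; exact: ltW.
  - by right; exact: ltW.
  - by left; exact: ltW.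
rewrite in_itv /= => /andP[ac cb] fc; exists c => //.
have na : a != c by apply/eqP => e; move: h; rewrite -fc -e ltxx andbF /=; case.
have nb : c != b by apply/eqP => e; move: h; rewrite -fc e ltxx andbF /=; case.
by rewrite !lt_neqAle na nb ac cb.
Qed.

Variable c : R -> R * R.
Hypothesis cc : {within `[0, 1], continuous c}.
Hypothesis cm : forall s t, 0 <= s <= 1 -> 0 <= t <= 1 ->
  (c s).1 = (c t).1 -> c s = c t.
Hypothesis cf : finite_set [set t | 0 < t < 1 /\
  exists s, [/\ 0 < s < 1, s <> t & c s = c t]].

Lemma curve_x_continuous : {within `[0, 1], continuous (fun t => (c t).1)}.
Proof. by apply: (within_compT (g := fst)) cc _ => p; exact: cvg_fst. Qed.

Lemma curve_y_continuous : {within `[0, 1], continuous (fun t => (c t).2)}.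
Proof. by apply: (within_compT (g := snd)) cc _ => p; exact: cvg_snd. Qed.

Lemma sub_continuous (f : R -> R) a b : {within `[0, 1], continuous f} ->
  0 <= a -> b <= 1 -> {within `[a, b], continuous f}.
Proof.
move=> h a0 b1; apply: continuous_subspaceW h => x /=.
by rewrite !in_itv /= => /andP[ax xb]; rewrite (le_trans a0) // (le_trans xb).
Qed.

(** Equality of points at equal abscissae still tolerates a curve that rests or retraces itself; the
    finiteness of self-crossings excludes both. *)
Lemma curve_x_neq s t : 0 <= s -> s < t -> t <= 1 -> (c s).1 <> (c t).1.
Proof.
move=> s0 st t1 e; have xc := curve_x_continuous.
pose P := [set t | 0 < t < 1 /\ exists s, [/\ 0 < s < 1, s <> t & c s = c t]].
have cP : finite_set P by exact: cf.
have [m hm] : exists m, s < m < t /\ (c m).1 <> (c s).1.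
  apply: contrapT => h; have {}h m : s < m < t -> (c m).1 = (c s).1.
    by move=> hm; apply: contrapT => n; apply: h; exists m.
  have [v [/andP[sv vt] nv]] := finite_avoid cP st; apply: nv.
  have v01 : 0 < v < 1 by apply/andP; split; lra.
  have [w hw] : exists w, v < w < t by exists ((v + t) / 2); apply/andP; split; lra.
  case/andP: hw => vw wt.
  split=> //; exists w; split=> //.
  - by apply/andP; split; lra.
  - by move=> wv; move: vw; rewrite wv ltxx.
  - apply: cm; [by apply/andP; split; lra|by apply/andP; split; lra|].
    by rewrite !h //; apply/andP; split; lra.
case: hm => /andP[sm mt] neq.
have cfx : finite_set ((fun t => (c t).1) @` P) by exact: finite_image.
(* Each such value is taken before and after [m], at two parameters that monotonicity sends to the
   same point. *)
have key v : (c s).1 < v < (c m).1 \/ (c m).1 < v < (c s).1 -> 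
    ((fun t => (c t).1) @` P) v.
  move=> hv.
  have [p /andP[sp pm] ep] := @ivt_open (fun t => (c t).1) _ _ v sm
    (sub_continuous xc s0 (ltW (lt_le_trans mt t1))) hv.
  have [|r /andP[mr rt] er] := @ivt_open (fun t => (c t).1) _ _ v mt
    (sub_continuous xc (le_trans s0 (ltW sm)) t1).
    by rewrite -e; case: hv => h; [right|left].
  exists p => //; split; first by apply/andP; split; lra.
  exists r; split.
  - by apply/andP; split; lra.
  - by move=> rp; move: pm mr; rewrite rp; lra.
  - apply: cm; [by apply/andP; split; lra|by apply/andP; split; lra|].
    by rewrite er ep.
case: (ltgtP (c s).1 (c m).1) => [lt|lt|]; last by move/esym.
  have [v [hv nv]] := finite_avoid cfx lt; apply: nv; apply: key; by left.
have [v [hv nv]] := finite_avoid cfx lt; apply: nv; apply: key; by right.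
Qed.

Hypothesis c01 : (c 0).1 < (c 1).1.
Local Notation x0 := (c 0).1.
Local Notation x1 := (c 1).1.

Lemma curve_x_mono : {in `[0, 1] &, {mono (fun t => (c t).1) : s t / s <= t}}.
Proof.
apply: itv_continuous_inj_le.
- by exists 0, 1; rewrite !in_itv /= !lexx !ler01 ltr01 ltW.
- exact: curve_x_continuous.
- move=> s t; rewrite !in_itv /= => /andP[s0 s1] /andP[t0 t1] e.
  case: (ltgtP s t) => // st; first by case: (curve_x_neq s0 st t1).
  by case: (curve_x_neq t0 st s1).
Qed.

Definition curve_inv (x : R) : R := xget 0 [set t | 0 <= t <= 1 /\ (c t).1 = x].

Lemma curve_invP x : x0 <= x <= x1 ->
  0 <= curve_inv x <= 1 /\ (c (curve_inv x)).1 = x.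
Proof.
move=> /andP[h0 h1]; rewrite /curve_inv; case: xgetP => [t _ //|h].
have [|t] := @IVT R (fun t => (c t).1) 0 1 x ler01 curve_x_continuous.
  by rewrite ge_min le_max h0 h1 orbT.
by rewrite in_itv /= => ht e; case: (h t).
Qed.

Lemma curve_invK t : 0 <= t <= 1 -> curve_inv (c t).1 = t.
Proof.
move=> ht; have m := curve_x_mono; have i0 : 0 \in `[0 : R, 1] by rewrite in_itv /= lexx ler01.
have i1 : 1 \in `[0 : R, 1] by rewrite in_itv /= lexx ler01.
have it : t \in `[0, 1] by rewrite in_itv.
have /andP[t0 t1] := ht.
have [] := @curve_invP (c t).1; first by rewrite m // t0 m.
move=> hi e; apply/eqP; rewrite eq_le -!(m _ _ _ it) -?(m _ _ it) ?e ?lexx ?in_itv //.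
Qed.

Lemma curve_inv_continuous : {within `[x0, x1], continuous curve_inv}.
Proof.
have m := curve_x_mono.
apply: segment_inc_surj_continuous.
  move=> x y; rewrite !in_itv /= => /curve_invP[hx ex] /curve_invP[hy ey].
  by rewrite -{2}ex -{2}ey m // in_itv.
move=> t /=; rewrite !curve_invK ?lexx ?ler01 // in_itv /= => ht.
exists (c t).1; last exact: curve_invK.
have it : t \in `[0, 1] by rewrite in_itv.
have /andP[t0 t1] := ht.
by rewrite /= in_itv /= !m ?in_itv /= ?lexx ?ler01 ?t0.
Qed.

Definition height (x : R) : R := (c (curve_inv x)).2.

Lemma height_continuous : {within `[x0, x1], continuous height}.
Proof.
have := @within_comp R R R `[x0, x1] `[0, 1] curve_inv (fun t => (c t).2)
  curve_inv_continuous _ curve_y_continuous.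
by apply=> x /=; rewrite !in_itv /= => /curve_invP[].
Qed.

Lemma height_param x : x0 < x < x1 ->
  exists2 t, 0 < t < 1 & c t = (x, height x).
Proof.
move=> /andP[h0 h1]; have [|/andP[t0 t1] e] := @curve_invP x.
  by rewrite !ltW.
exists (curve_inv x); last by rewrite /height -{2}e -surjective_pairing.
apply/andP; split; rewrite lt_neqAle ?t0 ?t1 andbT; apply/eqP => et.
  by move: h0; rewrite -e -et ltxx.
by move: h1; rewrite -e et ltxx.
Qed.

Lemma heightE t : 0 <= t <= 1 -> height (c t).1 = (c t).2.
Proof. by move=> ht; rewrite /height curve_invK. Qed.

End Curve.

(** * Drawings *)

Lemma conv_gt (R : realType) (u z a b : R) : 0 <= u <= 1 -> z < a -> z < b ->
  z < (1 - u) * a + u * b.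
Proof.
move=> /andP[u0 u1] za zb; have h1 : 0 <= (1 - u) * (a - z) by apply: mulr_ge0; lra.
case: (ltrgt0P u) u0 => // [u0 _|-> _]; last by lra.
have : 0 < u * (b - z) by apply: mulr_gt0 => //; lra.
by nra.
Qed.

Section DrawingGraphs.
Variables (R : realType) (G : multigraph) (D : drawing R G).
Hypothesis mono : monotone_drawing D.
Implicit Types (e f : edge G) (v w z : vertex G) (x t s : R).

Definition vx v : R := (vpoint D v).1.
Definition vy v : R := (vpoint D v).2.

Lemma self_crossings_finite e : finite_set [set t : R | 0 < t < 1 /\
  exists s, [/\ 0 < s < 1, s <> t & ecurve D e s = ecurve D e t]].
Proof.
apply: (@sub_finite_set _ _
   ((fun p : edge G * R => p.2) @` (\bigcup_(X in crossings (ecurve D)) X))).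
  move=> t [ht [s [hs st est]]]; exists (e, t) => //.
  exists [set (e, t); (e, s)]; last by left.
  by exists (e, t), (e, s); split=> //= -[/esym].
apply: finite_image; apply: bigcup_finite; first exact: crossings_finite.
by move=> _ [p [q [_ _ _ _ ->]]]; exact: finite_set2.
Qed.

(** In particular a monotone drawing has no loops. *)
Lemma ecurve_x_neq e : (ecurve D e 0).1 != (ecurve D e 1).1.
Proof.
apply/eqP; apply: (curve_x_neq (c := ecurve D e)) => //.
- exact: ecurve_continuous.
- by move=> s t; exact: mono.
- exact: self_crossings_finite.
Qed.

Definition forward e := (ecurve D e 0).1 < (ecurve D e 1).1.

Definition orient e t := if forward e then t else 1 - t.

Definition curve e t := ecurve D e (orient e t).

Lemma orient01 e t : (0 <= orient e t <= 1) = (0 <= t <= 1).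
Proof. by rewrite /orient; case: ifP => // _; apply/idP/idP => /andP[? ?]; apply/andP; split; lra. Qed.

Lemma orient_open e t : (0 < orient e t < 1) = (0 < t < 1).
Proof. by rewrite /orient; case: ifP => // _; apply/idP/idP => /andP[? ?]; apply/andP; split; lra. Qed.

Lemma orientK e : involutive (orient e).
Proof. by move=> t; rewrite /orient; case: (forward e) => //; rewrite opprB addrC subrK. Qed.

Lemma curve_continuous e : {within `[0, 1], continuous (curve e)}.
Proof.
have := @within_comp R R (R * R)%type `[0, 1] `[0, 1] (orient e) (ecurve D e) _ _
  (@ecurve_continuous _ _ D e).
apply.
  apply: continuous_subspaceT => t; rewrite /orient; case: (forward e); first exact: cvg_id.
  by apply: cvgB; [exact: cvg_cst|exact: cvg_id].
by move=> t /=; rewrite !in_itv /= orient01.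
Qed.

Lemma curve_mono e s t : 0 <= s <= 1 -> 0 <= t <= 1 ->
  (curve e s).1 = (curve e t).1 -> curve e s = curve e t.
Proof. by move=> hs ht; apply: mono; rewrite orient01. Qed.

Lemma curve_self_finite e : finite_set [set t : R | 0 < t < 1 /\
  exists s, [/\ 0 < s < 1, s <> t & curve e s = curve e t]].
Proof.
apply: (@sub_finite_set _ _ (orient e @` [set t : R | 0 < t < 1 /\
  exists s, [/\ 0 < s < 1, s <> t & ecurve D e s = ecurve D e t]])); last first.
  exact/finite_image/self_crossings_finite.
move=> t [ht [s [hs st est]]]; exists (orient e t); last exact: orientK.
split; first by rewrite orient_open.
exists (orient e s); split=> //; first by rewrite orient_open.
by move=> h; apply: st; rewrite -[s](orientK e) h orientK.
Qed.

Lemma curve_01 e : (curve e 0).1 < (curve e 1).1.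
Proof.
rewrite /curve /orient; case: ifP => // /negbT; rewrite -leNgt subr0 subrr.
by move=> le; rewrite lt_neqAle eq_sym ecurve_x_neq.
Qed.

Lemma curve_ends e : exists p : vertex G * vertex G,
  [/\ ends e = [set p.1; p.2]%SET, curve e 0 = vpoint D p.1 & curve e 1 = vpoint D p.2].
Proof.
have [v [w [h1 h2 h3]]] := ecurve_ends D e; rewrite /curve /orient; case: ifP => _.
  by exists (v, w).
by exists (w, v); split; rewrite /= ?subr0 ?subrr // finset.setUC.
Qed.

Definition lv e := (projT1 (cid (curve_ends e))).1.
Definition rv e := (projT1 (cid (curve_ends e))).2.

Lemma lvrvP e : [/\ ends e = [set lv e; rv e]%SET, curve e 0 = vpoint D (lv e) &
  curve e 1 = vpoint D (rv e)].
Proof. by rewrite /lv /rv; case: cid. Qed.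

Definition ht e : R -> R := height (curve e).

Lemma curve0 e : curve e 0 = (vx (lv e), vy (lv e)).
Proof. by have [_ -> _] := lvrvP e; exact: surjective_pairing. Qed.

Lemma curve1 e : curve e 1 = (vx (rv e), vy (rv e)).
Proof. by have [_ _ ->] := lvrvP e; exact: surjective_pairing. Qed.

Lemma vx_lt e : vx (lv e) < vx (rv e).
Proof. by have := curve_01 e; rewrite curve0 curve1. Qed.

Lemma htE e t : 0 <= t <= 1 -> ht e (curve e t).1 = (curve e t).2.
Proof.
exact: (heightE (@curve_continuous e) (@curve_mono e) (@curve_self_finite e) (curve_01 e)).
Qed.

Lemma ht_lv e : ht e (vx (lv e)) = vy (lv e).
Proof. by have := @htE e 0; rewrite curve0 /= lexx ler01; apply. Qed.

Lemma ht_rv e : ht e (vx (rv e)) = vy (rv e).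
Proof. by have := @htE e 1; rewrite curve1 /= lexx ler01; apply. Qed.

Lemma ht_continuous e : {within `[vx (lv e), vx (rv e)], continuous (ht e)}.
Proof.
have := height_continuous (@curve_continuous e) (@curve_mono e) (@curve_self_finite e) (curve_01 e).
by rewrite curve0 curve1.
Qed.

Lemma ht_param e x : vx (lv e) < x < vx (rv e) ->
  exists2 t, 0 < t < 1 & ecurve D e t = (x, ht e x).
Proof.
move=> hx; have := height_param (@curve_continuous e) (x := x).
rewrite curve0 curve1 => /(_ hx)[t ht01 et]; exists (orient e t) => //.
by rewrite orient_open.
Qed.

Lemma ht_avoid e x v : vx (lv e) < x < vx (rv e) -> vx v = x -> ht e x <> vy v.
Proof.
move=> /ht_param[t t01 et] vxe hv; apply: (@ecurve_avoid _ _ D e t v t01).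
by rewrite et hv -vxe -surjective_pairing.
Qed.

Lemma curve_x_in e t : 0 <= t <= 1 -> vx (lv e) <= (curve e t).1 <= vx (rv e).
Proof.
move=> ht01; have m := curve_x_mono (@curve_continuous e) (@curve_mono e) (@curve_self_finite e) (curve_01 e).
have /andP[t0 t1] := ht01.
have <- : (curve e 0).1 = vx (lv e) by rewrite curve0.
have <- : (curve e 1).1 = vx (rv e) by rewrite curve1.
by rewrite !m ?in_itv /= ?lexx ?ler01 ?t0.
Qed.

Lemma vpoint_eq v w : vx v = vx w -> vy v = vy w -> v = w.
Proof.
move=> hx hy; apply: (@vpoint_inj _ _ D).
by rewrite [LHS]surjective_pairing [RHS]surjective_pairing; congr (_, _).
Qed.

Lemma path_homotopic_reverse (U : {set vertex G}) (c d : R -> R * R) :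
  path_homotopic D U c d ->
  path_homotopic D U (fun t => c (1 - t)) (fun t => d (1 - t)).
Proof.
move=> [H [Hc H01 He Ha]]; exists (fun p => H (p.1, 1 - p.2)); split.
- have := @within_comp (R * R)%type (R * R)%type (R * R)%type
    (`[0, 1] `*` `[0, 1]) (`[0, 1] `*` `[0, 1]) (fun p => (p.1, 1 - p.2)) H _ _ Hc.
  apply.
    apply: within_pair; apply: continuous_subspaceT => p; first exact: cvg_fst.
    by apply: cvgB; [exact: cvg_cst|exact: cvg_snd].
  move=> [u t] /= [hu ht0]; split=> //=; move: ht0; rewrite !in_itv /= => /andP[? ?].
  by apply/andP; split; lra.
- by move=> t /andP[? ?] /=; apply: H01; apply/andP; split; lra.
- move=> u hu /=; have [h1 h2] := He u hu; rewrite subr0 subrr; split=> //.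
- by move=> u t x hu /andP[? ?] hx /=; apply: Ha => //; apply/andP; split; lra.
Qed.

Lemma path_homotopic_ext (U : {set vertex G}) (c d c' d' : R -> R * R) :
  c =1 c' -> d =1 d' -> path_homotopic D U c d -> path_homotopic D U c' d'.
Proof. by move=> /funext <- /funext <-. Qed.

(* The straight-line homotopy between the two graphs, evaluated along the convex
   combination of the two parametrizations. *)
Lemma same_sides_homotopic e f : lv e = lv f -> rv e = rv f ->
  (forall z, vx (lv e) < vx z < vx (rv e) ->
     (vy z < ht e (vx z)) = (vy z < ht f (vx z))) ->
  path_homotopic D (ends e) (curve e) (curve f).
Proof.
move=> el er hs.
pose X (p : R * R) := (1 - p.1) * (curve e p.2).1 + p.1 * (curve f p.2).1.
have Xin p : (`[0, 1] `*` `[0, 1])%classic p -> vx (lv e) <= X p <= vx (rv e).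
  case: p => u t [] /=; rewrite !in_itv /= => /andP[u0 u1] ht01.
  have /andP[a1 a2] := curve_x_in e ht01; have /andP[] := curve_x_in f ht01.
  by rewrite -el -er /X /= => b1 b2; apply/andP; split; nra.
have cfst : {within (`[0, 1] `*` `[0, 1]), continuous (fun p : R * R => p.1)}.
  by apply: continuous_subspaceT => p; exact: cvg_fst.
have csnd : {within (`[0, 1] `*` `[0, 1]), continuous (fun p : R * R => p.2)}.
  by apply: continuous_subspaceT => p; exact: cvg_snd.
have c1fst : {within (`[0, 1] `*` `[0, 1]), continuous (fun p : R * R => 1 - p.1)}.
  by apply: continuous_subspaceT => p; apply: cvgB; [exact: cvg_cst|exact: cvg_fst].
have cx g : {within (`[0, 1] `*` `[0, 1]), continuous (fun p : R * R => (curve g p.2).1)}.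
  have := @within_comp (R * R)%type R R (`[0, 1] `*` `[0, 1]) `[0, 1]
    (fun p => p.2) (fun t => (curve g t).1) csnd _ (curve_x_continuous (@curve_continuous g)).
  by apply=> -[u t] [].
have cX : {within (`[0, 1] `*` `[0, 1]), continuous X}.
  by move=> p; apply: cvgD; apply: cvgM; [exact: c1fst|exact: cx|exact: cfst|exact: cx].
have cY g : lv e = lv g -> rv e = rv g ->
    {within (`[0, 1] `*` `[0, 1]), continuous (fun p => ht g (X p))}.
  move=> hl hr; have := @within_comp (R * R)%type R R (`[0, 1] `*` `[0, 1])
    `[vx (lv g), vx (rv g)] X (ht g) cX _ (@ht_continuous g).
  by apply=> p /Xin; rewrite hl hr /= in_itv.
exists (fun p => (X p, (1 - p.1) * ht e (X p) + p.1 * ht f (X p))); split.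
- apply: within_pair => //.
  by move=> p; apply: cvgD; apply: cvgM; [exact: c1fst|exact: cY|exact: cfst|exact: cY].
- move=> t ht01; rewrite /X /= !subr0 !subrr !mul0r !mul1r !addr0 !add0r.
  by rewrite !htE // -!surjective_pairing.
- move=> u hu; rewrite /X /= !curve0 !curve1 /= -el -er -!mulrDl !subrK !mul1r ht_lv ht_rv.
  by rewrite el ht_lv er ht_rv -!mulrDl !subrK !mul1r.
- move=> u t z hu ht01; have [-> _ _] := lvrvP e.
  rewrite !inE negb_or => /andP[/eqP nl /eqP nr] hz.
  have ey : _ = vy z := congr1 (fun p : R * R => p.2) hz.
  have : _ = vx z := congr1 (fun p : R * R => p.1) hz.
  move: ey => /=; set x := X (u, t) => ey ex.
  have /andP[lx xr] : vx (lv e) <= x <= vx (rv e) by apply: Xin; split; rewrite /= in_itv.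
  case: (eqVneq x (vx (lv e))) => [xl|xl].
    apply: nl; apply: vpoint_eq; first by rewrite -xl ex.
    by move: ey; rewrite xl ht_lv el ht_lv -mulrDl subrK mul1r.
  case: (eqVneq x (vx (rv e))) => [xr'|xr'].
    apply: nr; apply: vpoint_eq; first by rewrite -xr' ex.
    by move: ey; rewrite xr' ht_rv er ht_rv -mulrDl subrK mul1r.
  have lx' : vx (lv e) < x by rewrite lt_neqAle eq_sym xl.
  have xr2 : x < vx (rv e) by rewrite lt_neqAle xr'.
  have exz : vx z = x by rewrite ex.
  have := hs z; rewrite exz lx' xr2 => /(_ isT).
  have /eqP n1 : ht e x <> vy z by apply: ht_avoid => //; rewrite lx'.
  have /eqP n2 : ht f x <> vy z by apply: ht_avoid => //; rewrite -el -er lx'.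
  case: (ltgtP (vy z) (ht e x)) n1 => [h1 _|h1 _|//].
    by move=> /esym h2; have := conv_gt hu h1 h2; rewrite ey ltxx.
  move=> /esym/negbT; rewrite -leNgt le_eqVlt (negbTE n2) /= => h2.
  have := @conv_gt R u (- vy z) (- ht e x) (- ht f x) hu.
  by rewrite !ltrN2 => /(_ h1 h2); rewrite !mulrN -opprD ltrN2 ey ltxx.
Qed.

Hypothesis nonhom : non_homotopic D.

(** Contrapositive of [same_sides_homotopic]. The four cases translate curves directed from left to
    right back to the given parametrizations, where a homotopy is allowed to reverse [f]. *)
Lemma parallel_separated e f : e != f -> lv e = lv f -> rv e = rv f ->
  exists2 z, vx (lv e) < vx z < vx (rv e) &
    (vy z < ht e (vx z)) <> (vy z < ht f (vx z)).
Proof.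
move=> /eqP nef el er; apply: contrapT => h.
have par : parallel e f.
  by rewrite /parallel; have [-> _ _] := lvrvP e; have [-> _ _] := lvrvP f; rewrite el er.
apply: (nonhom nef par).
have ph : path_homotopic D (ends e) (curve e) (curve f).
  apply: same_sides_homotopic => // z hz; apply: contrapT => n; apply: h; by exists z.
have E0 g : forward g -> curve g =1 ecurve D g by move=> h0 t; rewrite /curve /orient h0.
have E1 g : ~~ forward g -> curve g =1 (fun t => ecurve D g (1 - t)).
  by move=> /negbTE h0 t; rewrite /curve /orient h0.
have E2 g : ~~ forward g -> (fun t => curve g (1 - t)) =1 ecurve D g.
  by move=> h0 t; rewrite E1 // opprB addrC subrK.
have E3 g : forward g -> (fun t => curve g (1 - t)) =1 (fun t => ecurve D g (1 - t)).
  by move=> h0 t; rewrite E0.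
case: (boolP (forward e)) => fe; case: (boolP (forward f)) => ff.
- by left; apply: path_homotopic_ext ph; exact: E0.
- by right; apply: path_homotopic_ext ph; [exact: E0|exact: E1].
- by right; apply: path_homotopic_ext (path_homotopic_reverse ph); [exact: E2|exact: E3].
- by left; apply: path_homotopic_ext (path_homotopic_reverse ph); exact: E2.
Qed.

End DrawingGraphs.

(** * Gaps between abscissae and injective ranks *)

Lemma exists_gap_left (R : realType) (r : seq R) (X : R) :
  exists2 x, x < X & forall y, y \in r -> y < X -> y < x.
Proof.
elim: r => [|y r [x xX hx]]; first by exists (X - 1) => //; lra.
case: (ltP y X) => yX.
  exists (Num.max x ((y + X) / 2)); first by rewrite gt_max xX /=; lra.
  move=> w; rewrite inE lt_max => /orP[/eqP-> _|wr wX]; last by rewrite hx.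
  by apply/orP; right; lra.
exists x => // w; rewrite inE => /orP[/eqP->|]; last exact: hx.
by rewrite ltNge yX.
Qed.

Lemma exists_gap_right (R : realType) (r : seq R) (X : R) :
  exists2 x, X < x & forall y, y \in r -> X < y -> x < y.
Proof.
have [x xX hx] := exists_gap_left [seq - y | y <- r] (- X).
exists (- x); first by rewrite ltrNr.
by move=> y yr Xy; rewrite ltrNl hx ?ltrN2 //; exact: map_f.
Qed.

Section KeyRank.
Variables (E : finType) (R : realType) (key : E -> R).
(** Edges that meet may have equal heights; ties are broken by the enumeration, so that the rank is
    injective. *)
Definition key_rank (f : E) : nat :=
  #|[set h | (key h < key f) || ((key h == key f) && (enum_rank h < enum_rank f)%N)]%SET|.

Lemma key_rank_lt h f :
  (key h < key f) || ((key h == key f) && (enum_rank h < enum_rank f)%N) ->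
  (key_rank h < key_rank f)%N.
Proof.
move=> hf; apply: proper_card; apply/properP; split.
  apply/fintype.subsetP => g; rewrite !inE.
  case/orP: hf => [hf|/andP[/eqP hf rf]]; case/orP => [gh|/andP[/eqP gh rg]].
  - by rewrite (lt_trans gh hf).
  - by rewrite gh hf.
  - by rewrite -hf gh.
  - by rewrite gh hf eqxx (ltn_trans rg rf) orbT.
by exists h; rewrite inE // ltxx ltnn andbF.
Qed.

Lemma key_rank_total h f : h != f ->
  (key_rank h < key_rank f)%N /\ key h <= key f \/
  (key_rank f < key_rank h)%N /\ key f <= key h.
Proof.
move=> hf; case: (ltgtP (key h) (key f)) => e.
- by left; split; [apply: key_rank_lt; rewrite e|].
- by right; split; [apply: key_rank_lt; rewrite e|].
case: (ltngtP (enum_rank h) (enum_rank f)) => r.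
- by left; split=> //; apply: key_rank_lt; rewrite e eqxx r orbT.
- by right; split=> //; apply: key_rank_lt; rewrite e eqxx r orbT.
- by case/eqP: hf; exact/enum_rank_inj/val_inj.
Qed.

Lemma key_rank_inj : injective key_rank.
Proof.
move=> h f e; apply/eqP; apply: contraT => /key_rank_total.
by rewrite e ltnn => -[[]|[]].
Qed.

Lemma key_rank_le h f : (key_rank h < key_rank f)%N -> key h <= key f.
Proof.
move=> r; have hf : h != f by apply: contraTneq r => ->; rewrite ltnn.
by case: (key_rank_total hf) => [[]//|[r' _]]; move: (ltn_trans r r'); rewrite ltnn.
Qed.
End KeyRank.

(** * The layered structure of a monotone drawing *)

Section Layers.
Variables (R : realType) (G : multigraph) (D : drawing R G).
Hypothesis mono : monotone_drawing D.
Implicit Types (e f g h : edge G) (v w z : vertex G) (x t s : R).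
Local Notation vx := (vx D).
Local Notation vy := (vy D).
Local Notation lv := (lv D).
Local Notation rv := (rv D).
Local Notation ht := (ht D).

Definition inside e x := vx (lv e) < x < vx (rv e).
Definition covers e x := vx (lv e) <= x <= vx (rv e).
Definition meet_at e f x := [/\ inside e x, inside f x & ht e x = ht f x].
Definition mt e f := (e != f) && `[< exists x, meet_at e f x >].
(** One witness is enough: by the intermediate value theorem, edges that do not meet keep their
    vertical order over the common range. The ranges are closed in order to compare ends as well. *)
Definition lo e f := `[< exists x, [/\ covers e x, covers f x & ht e x < ht f x] >].

Lemma inside_covers e x : inside e x -> covers e x.
Proof. by move=> /andP[/ltW h1 /ltW h2]; apply/andP. Qed.

Lemma mt_irr : irreflexive mt.
Proof. by move=> e; rewrite /mt eqxx. Qed.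

Lemma mt_sym : symmetric mt.
Proof.
move=> e f; rewrite /mt eq_sym; congr (_ && _); apply/idP/idP => /asboolP[x [? ? ?]];
  by apply/asboolP; exists x.
Qed.

Lemma meet_between e f x y : x < y -> covers e x -> covers e y -> covers f x -> covers f y ->
  (ht e x < ht f x /\ ht f y < ht e y) \/ (ht f x < ht e x /\ ht e y < ht f y) ->
  exists2 s, x < s < y & meet_at e f s.
Proof.
move=> xy /andP[ex1 ex2] /andP[ey1 ey2] /andP[fx1 fx2] /andP[fy1 fy2] h.
have cg g : vx (lv g) <= x -> y <= vx (rv g) -> {within `[x, y], continuous (ht g)}.
  move=> h1 h2; have hg := @ht_continuous R G D mono g.
  apply: continuous_subspaceW hg => s /=.
  by rewrite !in_itv /= => /andP[? ?]; apply/andP; split; lra.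
have cd : {within `[x, y], continuous (fun s => ht e s - ht f s)}.
  by move=> s; apply: cvgB; [exact: cg|exact: cg].
have [|s /andP[xw wy] ew] := @ivt_open R (fun s => ht e s - ht f s) x y 0 xy cd.
  by case: h => -[h1 h2]; [left|right]; apply/andP; split; lra.
exists s; first by rewrite xw.
by split; [apply/andP; split; lra|apply/andP; split; lra|lra].
Qed.

Lemma lo_asym e f : ~~ mt e f -> lo e f -> lo f e -> False.
Proof.
move=> nm /asboolP[x [ex fx h1]] /asboolP[y [fy ey h2]].
have nef : e != f by apply: contraTneq h1 => ->; rewrite ltxx.
move: nm; rewrite /mt nef /= => /asboolPn; apply.
case: (ltgtP x y) => xy.
- by have [|s _ hw] := @meet_between e f x y xy ex ey fx fy; [left|exists s].
- by have [|s _ hw] := @meet_between e f y x xy ey ex fy fx; [right|exists s].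
- by move: h1 h2; rewrite xy; lra.
Qed.

Lemma lo_at e f x : covers e x -> covers f x -> ht e x < ht f x -> lo e f.
Proof. by move=> h1 h2 h3; apply/asboolP; exists x. Qed.

Lemma lo_inside e f x : e != f -> ~~ mt e f -> inside e x -> inside f x ->
  ht e x <= ht f x -> lo e f.
Proof.
move=> nef; rewrite /mt nef /= => /asboolPn nm he hf; rewrite le_eqVlt => /orP[/eqP h|h].
  by case: nm; exists x.
by apply: (@lo_at _ _ x) => //; exact: inside_covers.
Qed.

(** Vertices may share an abscissa. Ordering them by height within a vertical line amounts to
    tilting all vertical lines slightly. *)
Definition lexlt v w := (vx v < vx w) || ((vx v == vx w) && (vy v < vy w)).

Definition idx v : nat := #|[set w | lexlt w v]%SET|.

Lemma lexlt_trans v w z : lexlt v w -> lexlt w z -> lexlt v z.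
Proof.
rewrite /lexlt => /orP[h1|/andP[/eqP h1 h1']] /orP[h2|/andP[/eqP h2 h2']].
- by rewrite (lt_trans h1).
- by rewrite -h2 h1.
- by rewrite h1 h2.
- by rewrite h1 h2 eqxx (lt_trans h1') ?orbT.
Qed.

Lemma lexlt_irr v : lexlt v v = false.
Proof. by rewrite /lexlt !ltxx andbF. Qed.

Lemma idx_lt v w : lexlt v w -> (idx v < idx w)%N.
Proof.
move=> vw; apply: proper_card; apply/properP; split.
  by apply/fintype.subsetP => z; rewrite !inE => zv; exact: lexlt_trans vw.
by exists v; rewrite inE ?lexlt_irr.
Qed.

Lemma lexlt_total v w : v != w -> lexlt v w || lexlt w v.
Proof.
move=> vw; rewrite /lexlt; case: (ltgtP (vx v) (vx w)) => //= ex.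
case: (ltgtP (vy v) (vy w)) => //= ey.
by case/eqP: vw; exact: vpoint_eq ex ey.
Qed.

Lemma idxE v w : (idx v < idx w)%N = lexlt v w.
Proof.
apply/idP/idP => [h|]; last exact: idx_lt.
case: (eqVneq v w) => [e|/lexlt_total/orP[//|/idx_lt h']]; first by rewrite e ltnn in h.
by move: (ltn_trans h h'); rewrite ltnn.
Qed.

Lemma idx_inj : injective idx.
Proof.
move=> v w e; apply/eqP; apply: contraT => /lexlt_total; rewrite -!idxE e ltnn.
by [].
Qed.

Lemma idx_bound v : (idx v < #|vertex G|)%N.
Proof.
rewrite -cardsT; apply: proper_card; apply/properP; split; first exact: finset.subsetT.
by exists v; rewrite inE ?lexlt_irr.
Qed.

Lemma idx_le_vx v w : (idx v <= idx w)%N -> vx v <= vx w.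
Proof.
rewrite leq_eqVlt => /orP[/eqP/idx_inj-> //|]; rewrite idxE => /orP[/ltW//|/andP[/eqP-> _]].
exact: lexx.
Qed.

Lemma idx_surj (u : nat) : (u < #|vertex G|)%N -> exists v, idx v = u.
Proof.
move=> uN; pose F v := Ordinal (idx_bound v).
have Finj : injective F by move=> v w /(congr1 val) /= /idx_inj.
have := inj_card_onto Finj; rewrite card_ord => /(_ (leqnn _) (Ordinal uN))/codomP[v].
by move=> /(congr1 val) /= ->; exists v.
Qed.

Definition lf e := idx (lv e).
Definition rt e := idx (rv e).
Definition ab e (u : nat) := [exists z, (idx z == u) && (vy z < ht e (vx z))].

Lemma abE e z : ab e (idx z) = (vy z < ht e (vx z)).
Proof.
apply/existsP/idP => [[w /andP[/eqP/idx_inj-> //]]|h]; by exists z; rewrite eqxx.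
Qed.

Lemma lf_rt e : (lf e < rt e)%N.
Proof. by rewrite idxE /lexlt (vx_lt mono). Qed.

Lemma rt_bound e : (rt e < #|vertex G|)%N.
Proof. exact: idx_bound. Qed.

Lemma passes_vertex e u : passes lf rt e u -> exists2 z, u = idx z & passes lf rt e (idx z).
Proof.
move=> p; have /andP[_ h] := p.
by have [z ez] := idx_surj (ltn_trans h (rt_bound e)); exists z; rewrite ez.
Qed.

Lemma passes_covers e z : passes lf rt e (idx z) -> covers e (vx z).
Proof. by move=> /andP[/ltnW h1 /ltnW h2]; apply/andP; split; exact: idx_le_vx. Qed.

(** An edge that starts on the vertical line of [z] and passes [z] in the index order starts below
    [z], so it is not above it. Dually, an edge passing below [z] extends strictly to its right. *)
Lemma passes_above e z : passes lf rt e (idx z) -> ab e (idx z) ->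
  vx (lv e) < vx z <= vx (rv e).
Proof.
move=> p; have /andP[h1 ->] := passes_covers p; rewrite abE andbT => a.
rewrite lt_neqAle h1 andbT; apply/eqP => ex; have /andP[+ _] := p.
rewrite idxE /lexlt ex ltxx eqxx /= => h; move: a; rewrite -ex ht_lv //.
by move=> /(lt_trans h); rewrite ltxx.
Qed.

Lemma passes_below e z : passes lf rt e (idx z) -> ~~ ab e (idx z) ->
  ht e (vx z) < vy z /\ vx (lv e) <= vx z < vx (rv e).
Proof.
move=> p; have /andP[h1 h2] := passes_covers p; rewrite abE -leNgt => a.
have nr : vx z <> vx (rv e).
  move=> ex; have /andP[_ +] := p; rewrite idxE /lexlt ex ltxx eqxx /= => h.
  by move: a; rewrite ex ht_rv // leNgt h.
have h2' : vx z < vx (rv e) by rewrite lt_neqAle h2 andbT; apply/eqP.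
rewrite h1 h2'; split=> //; rewrite lt_neqAle a andbT; apply/eqP => ey.
move: h1; rewrite le_eqVlt => /orP[/eqP ex|h1'].
  have /andP[+ _] := p; rewrite idxE /lexlt ex ltxx eqxx /= -ey -ex ht_lv //.
  by rewrite ltxx.
have hi : vx (lv e) < vx z < vx (rv e) by rewrite h1'.
by have := @ht_avoid R G D e (vx z) z hi erefl; rewrite ey.
Qed.

Lemma layered_drawing : layered lf rt ab mt lo.
Proof.
split.
- exact: lf_rt.
- move=> e f nef nm h1 h2.
  suff : lo e f || lo f e.
    have := @lo_asym e f nm; case: (lo e f); case: (lo f e) => // h _.
    by case: h.
  have le1 := idx_le_vx (ltnW h1); have le2 := idx_le_vx (ltnW h2).
  have ve := vx_lt mono e; have vf := vx_lt mono f.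
  (* Ranges that overlap in the index order may share a single abscissa; the tie-break then orders
     the two ends on that line. *)
  have [h|ex] : (vx (lv e) < vx (rv f) /\ vx (lv f) < vx (rv e)) \/
      (vx (lv e) = vx (rv f) \/ vx (lv f) = vx (rv e)).
    move: le1 le2; rewrite !le_eqVlt => /orP[/eqP ?|?] /orP[/eqP ?|?]; by [left|right; left|right; right].
    case: h => o1 o2.
    pose a := Num.max (vx (lv e)) (vx (lv f)); pose b := Num.min (vx (rv e)) (vx (rv f)).
    have ab' : a < b by rewrite gt_max !lt_min ve vf o1 o2.
    pose x := (a + b) / 2; have ax : a < x by rewrite /x; lra.
    have xb : x < b by rewrite /x; lra.
    move: ax xb; rewrite gt_max lt_min => /andP[xe xf] /andP[xe' xf'].
    have ie : inside e x by apply/andP.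
    have if' : inside f x by apply/andP.
    case/orP: (le_total (ht e x) (ht f x)) => h.
      by rewrite (lo_inside nef nm ie if' h).
    by rewrite (@lo_inside f e x) ?orbT // 1?eq_sym // mt_sym.
  case: ex => ex.
    have w1 : covers e (vx (lv e)) by rewrite /covers lexx ltW.
    have w2 : covers f (vx (lv e)) by rewrite /covers ex lexx andbT ltW.
    rewrite (lo_at w1 w2) // ht_lv // ex ht_rv //.
    by move: h1; rewrite idxE /lexlt ex ltxx eqxx.
  have w1 : covers f (vx (lv f)) by rewrite /covers lexx ltW.
  have w2 : covers e (vx (lv f)) by rewrite /covers ex lexx andbT ltW.
  rewrite [X in _ || X](lo_at w1 w2) ?orbT // ht_lv // ex ht_rv //.
  by move: h2; rewrite idxE /lexlt ex ltxx eqxx.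
- move=> e f u nm /passes_vertex[z -> pe] pf be af.
  have [h1 _] := passes_below pe be; move: af; rewrite abE => h2.
  by apply: (@lo_at _ _ (vx z)); [exact: passes_covers|exact: passes_covers|exact: lt_trans h2].
- move=> e f nm p; have w1 := passes_covers p.
  have w2 : covers f (vx (lv f)) by rewrite /covers lexx ltW // (vx_lt mono).
  case E : (ab e (lf f)).
    apply/negbTE/negP => h; apply: (lo_asym nm h); apply: (lo_at w2 w1).
    by rewrite ht_lv // -abE.
  have [h _] := passes_below p (negbT E); apply: (lo_at w1 w2); by rewrite [X in _ < X]ht_lv.
- move=> e f nm p; have w1 := passes_covers p.
  have w2 : covers f (vx (rv f)) by rewrite /covers lexx andbT ltW // (vx_lt mono).
  case E : (ab e (rt f)).
    apply/negbTE/negP => h; apply: (lo_asym nm h); apply: (lo_at w2 w1).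
    by rewrite ht_rv // -abE.
  have [h _] := passes_below p (negbT E); apply: (lo_at w1 w2); by rewrite [X in _ < X]ht_rv.
Qed.

End Layers.

(** * From alternations of words to crossings *)

Section CountCrossings.
Variables (R : realType) (G : multigraph) (D : drawing R G).
Hypothesis mono : monotone_drawing D.
Implicit Types (e f g h : edge G) (v w z : vertex G) (x t s : R).
Local Notation vx := (vx D).
Local Notation vy := (vy D).
Local Notation lv := (lv D).
Local Notation rv := (rv D).
Local Notation ht := (ht D).
Local Notation idx := (idx D).
Local Notation lf := (lf D).
Local Notation rt := (rt D).
Local Notation ab := (ab D).
Local Notation mt := (mt D).
Local Notation lo := (lo D).
Local Notation meet_at := (meet_at D).

Definition left_of z : R :=
  projT1 (cid2 (exists_gap_left [seq vx v | v <- enum (vertex G)] (vx z))).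
Definition right_of z : R :=
  projT1 (cid2 (exists_gap_right [seq vx v | v <- enum (vertex G)] (vx z))).

Lemma left_ofP z : left_of z < vx z /\ forall v, vx v < vx z -> vx v < left_of z.
Proof.
rewrite /left_of; case: cid2 => x xz h /=; split=> // v vz; apply: h => //.
by apply: map_f; rewrite mem_enum.
Qed.

Lemma right_ofP z : vx z < right_of z /\ forall v, vx z < vx v -> right_of z < vx v.
Proof.
rewrite /right_of; case: cid2 => x xz h /=; split=> // v vz; apply: h => //.
by apply: map_f; rewrite mem_enum.
Qed.

(** Edges above [z] are all present just left of it and edges below [z] just right of it, so their
    heights are compared there, at an abscissa beyond which no vertex comes before [z]. The sign
    makes the key grow with the distance from [z]. *)
Definition side_key (u : nat) (s : bool) f : R :=
  if [pick z | idx z == u] is Some z then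
    (if s then ht f (left_of z) else - ht f (right_of z))
  else 0.

Lemma side_keyE z (s : bool) f : side_key (idx z) s f =
  if s then ht f (left_of z) else - ht f (right_of z).
Proof.
rewrite /side_key; case: pickP => [w /eqP/idx_inj -> //|/(_ z)].
by rewrite eqxx.
Qed.

Definition start_key f : R := ht f (right_of (lv f)).

Lemma ranked_drawing : ranked lf rt ab mt lo
  (fun u (s : bool) => key_rank (side_key u s)) (key_rank start_key).
Proof.
split.
- by move=> u s f h _ _; exact: key_rank_inj.
- move=> u s f h; rewrite !inE => /andP[pf /eqP af] /andP[ph /eqP ah] nm r.
  have nfh : f != h by apply: contraTneq r => ->; rewrite ltnn.
  have nm' : ~~ mt h f by rewrite mt_sym.
  have [z eu pf'] := passes_vertex pf; subst u.
  have := key_rank_le r; rewrite !side_keyE; case: s af ah {r} => af ah.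
    have [l1 l2] := left_ofP z.
    have ins g : passes lf rt g (idx z) -> ab g (idx z) -> inside D g (left_of z).
      move=> pg ag; have /andP[h1 h2] := passes_above mono pg ag.
      by rewrite /inside l2 // (lt_le_trans l1).
    by apply: lo_inside => //; [rewrite eq_sym|exact: ins|exact: ins].
  have [r1 r2] := right_ofP z.
  have ins g : passes lf rt g (idx z) -> ab g (idx z) = false -> inside D g (right_of z).
    move=> pg ag; have [_ /andP[h1 h2]] := passes_below mono pg (negbT ag).
    by rewrite /inside r2 // (le_lt_trans h1).
  by rewrite lerN2; apply: lo_inside => //; exact: ins.
- move=> f h elf nfh nm; have elv : lv f = lv h by exact: (@idx_inj _ _ D).
  have nm' : ~~ mt h f by rewrite mt_sym.
  have [r1 r2] := right_ofP (lv f).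
  have i1 : inside D f (right_of (lv f)) by rewrite /inside r1 r2 // vx_lt.
  have i2 : inside D h (right_of (lv f)) by rewrite /inside -elv r1 r2 // elv vx_lt.
  case: (key_rank_total start_key nfh) => -[r le].
    rewrite ltnNge (ltnW r) /=; apply/esym/negbTE/negP => /(lo_asym mono nm'); apply.
    by apply: (lo_inside nfh nm i1 i2); move: le; rewrite /start_key -elv.
  rewrite r; apply/esym; apply: (@lo_inside _ _ D h f (right_of (lv f))) => //.
    by rewrite eq_sym.
  by move: le; rewrite /start_key -elv.
Qed.

Lemma separated_drawing : non_homotopic D ->
  separated lf rt ab (iota 0 #|vertex G|) [set: edge G]%SET.
Proof.
move=> nh e f _ _ nef el er; have elv : lv e = lv f by exact: (@idx_inj _ _ D).
have erv : rv e = rv f by exact: (@idx_inj _ _ D).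
have [z /andP[h1 h2] hz] := parallel_separated mono nh nef elv erv.
exists (idx z); first by rewrite mem_iota add0n idx_bound.
split; last by rewrite !abE.
by rewrite /passes !idxE /lexlt h1 h2.
Qed.

Lemma letter_height e (u : nat) : (0 < letter lf rt ab e u)%N ->
  exists z, [/\ u = idx z, covers D e (vx z) &
    [/\ letter lf rt ab e u = 1%N -> ht e (vx z) < vy z,
        letter lf rt ab e u = 2%N -> ht e (vx z) = vy z,
        letter lf rt ab e u = 3%N -> vy z < ht e (vx z) &
        (letter lf rt ab e u <= 3)%N]].
Proof.
rewrite /letter; case: ifP => [/orP[/eqP->|/eqP->] _|_].
- exists (lv e); split; rewrite /covers ?lexx ?ltW ?vx_lt //; split=> // _.
  exact: ht_lv.
- exists (rv e); split; rewrite /covers ?lexx ?andbT ?ltW ?vx_lt //; split=> // _.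
  exact: ht_rv.
case: ifP => // p; have [z eu pz] := passes_vertex p; subst u.
case E : (ab e (idx z)) => _; exists z; (split; [by []|exact: passes_covers|]).
  by split=> // _; rewrite -abE.
by split=> // _; have [] := passes_below mono pz (negbT E).
Qed.

Lemma cmp_height e f (u : nat) b : cmp b (letter lf rt ab e u) (letter lf rt ab f u) ->
  exists z, [/\ u = idx z, covers D e (vx z), covers D f (vx z) &
    if b then ht e (vx z) < ht f (vx z) else ht f (vx z) < ht e (vx z)].
Proof.
case/and3P => pe pf cb; have [z [ez cz [e1 e2 e3 e4]]] := letter_height pe.
have [z' [ez' cz' [f1 f2 f3 f4]]] := letter_height pf.
have zz : z' = z by apply: (@idx_inj _ _ D); rewrite -ez.
subst z'; exists z; split=> //; move: pe pf cb e1 e2 e3 e4 f1 f2 f3 f4.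
case: (letter lf rt ab e u) => [|[|[|[|a]]]] // _;
case: (letter lf rt ab f u) => [|[|[|[|a']]]] // _; case: b => // _ e1 e2 e3 _ f1 f2 f3 _.
- by rewrite (f2 erefl) (e1 erefl).
- exact: lt_trans (e1 erefl) (f3 erefl).
- by rewrite (e2 erefl) (f1 erefl).
- by rewrite (e2 erefl) (f3 erefl).
- exact: lt_trans (f1 erefl) (e3 erefl).
- by rewrite (f2 erefl) (e3 erefl).
Qed.

(** Opposite comparisons cannot occur at one abscissa, so between two consecutive ones the heights
    cross at an inner point. As words run from right to left, each new point lies to the right of
    those already found. *)
Lemma alternation_meets zs e f b j : path.sorted geq zs ->
  altn b j.+1 (word lf rt ab zs e) (word lf rt ab zs f) ->
  exists z, exists xs : seq R, [/\ idx z \in zs, covers D e (vx z) /\ covers D f (vx z),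
    (if b then ht e (vx z) < ht f (vx z) else ht f (vx z) < ht e (vx z)),
    size xs = j /\ uniq xs &
    forall x, x \in xs -> x < vx z /\ meet_at e f x].
Proof.
elim: zs b j => // u zs IH b j pz; rewrite [word _ _ _ _ e]/= [word _ _ _ _ f]/=.
rewrite [altn _ _ _ _]/= => /orP[/andP[/cmp_height[z [eu ce cf sg]]]|]; last first.
  move=> /(IH _ _ (path_sorted pz))[z [xs [h1 h2 h3 h4 h5]]].
  by exists z, xs; split=> //; rewrite inE h1 orbT.
case: j => [_|j].
  by exists z, [::]; split=> //; rewrite inE eu eqxx.
move=> /(IH _ _ (path_sorted pz))[z' [xs [h1 [ce' cf'] h3 [h4 h4'] h5]]].
have le : vx z' <= vx z.
  apply: idx_le_vx; rewrite -eu; move: pz; rewrite /= path_sortedE; last exact: rev_trans leq_trans.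
  by move=> /andP[/allP/(_ _ h1)].
have lt : vx z' < vx z.
  rewrite lt_neqAle le andbT; apply/eqP => ex; move: h3 sg; rewrite ex.
  by case: b => /= h3 sg; move: (lt_trans h3 sg); rewrite ltxx.
have [|x /andP[x1 x2] mx] := meet_between mono lt ce' ce cf' cf.
  by case: b h3 sg => /= h3 sg; [right|left].
exists z, (x :: xs); split=> //; first by rewrite inE eu eqxx.
  rewrite /= h4 h4' andbT; split=> //; apply/negP => /h5[xz' _].
  by move: (lt_trans x1 xz'); rewrite ltxx.
move=> y; rewrite inE => /orP[/eqP->//|/h5[y1 my]]; split=> //.
exact: lt_trans y1 lt.
Qed.

Lemma meet_crossing e f x : e <> f -> meet_at e f x -> exists p : R * R,
  crossings (ecurve D) [set (e, p.1); (f, p.2)] /\ (ecurve D e p.1).1 = x.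
Proof.
move=> nef [/ht_param[s s01 es] /ht_param[t t01 et] eh].
exists (s, t); split; last by rewrite /= es.
exists (e, s), (f, t); split=> //=; first by case.
by rewrite es et eh.
Qed.

Lemma pair_set_eq e f e' f' (s t s' t' : R) :
  [set (e, s); (f, t)] = [set (e', s'); (f', t')] ->
  ((e, s) = (e', s') \/ (e, s) = (f', t')) /\ ((f, t) = (e', s') \/ (f, t) = (f', t')).
Proof.
move=> h; split.
  have : [set (e, s); (f, t)] (e, s) by left.
  by rewrite h => -[]; [left|right].
have : [set (e, s); (f, t)] (f, t) by right.
by rewrite h => -[]; [left|right].
Qed.

Lemma meets_le_crossings e f (xs : seq R) : e <> f -> uniq xs ->
  (forall x, x \in xs -> meet_at e f x) -> (size xs <= num_crossings_between D e f)%N.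
Proof.
move=> nef ux hx.
pose K x : set (edge G * R) := if pselect (meet_at e f x) is left m
  then let p := projT1 (cid (meet_crossing nef m)) in [set (e, p.1); (f, p.2)] else set0.
pose S := [set X | crossings (ecurve D) X /\ exists s t : R, X = [set (e, s); (f, t)]].
have finS : finite_set S.
  by apply: sub_finite_set (crossings_finite D) => X [].
have KS x : x \in xs -> K x \in fset_set S.
  move=> /hx m; rewrite in_fset_set // inE /K; case: pselect => // m'.
  by case: cid => p [/= h1 h2]; split=> //; exists p.1, p.2.
have Kinj : {in xs &, injective K}.
  move=> x y /hx mx /hx my; rewrite /K; case: pselect => // mx'; case: pselect => // my'.
  case: cid => p [_ /= p2]; case: cid => p' [_ /= p2'] /pair_set_eq[[[es]|[ef]] _] //.
  by rewrite -p2 -p2' es.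
rewrite /num_crossings_between -/S -(size_map K); apply: uniq_leq_size.
  by rewrite map_inj_in_uniq.
by move=> _ /mapP[x xin ->]; exact: KS.
Qed.

Lemma alternation_crossings zs e f b j : path.sorted geq zs -> e != f ->
  altn b j.+1 (word lf rt ab zs e) (word lf rt ab zs f) ->
  (j <= num_crossings_between D e f)%N.
Proof.
move=> pz /eqP nef /(alternation_meets pz)[z [xs [_ _ _ [<- ux] h]]].
by apply: meets_le_crossings => // x /h[].
Qed.

Lemma alternation_mt zs e f b : path.sorted geq zs -> e != f ->
  altn b 2 (word lf rt ab zs e) (word lf rt ab zs f) -> mt e f.
Proof.
move=> pz nef /(alternation_meets pz)[z [[|x xs] [_ _ _ [sx _] h]]] //.
rewrite /mt nef /=; apply/asboolP; exists x; have [] := h x; first by rewrite inE eqxx.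
by [].
Qed.

(** One crossing per unordered pair of meeting edges is enough here; pairs of distinct edges give
    distinct crossings. *)
Lemma sum_mt_le : (\sum_f #|[set h | mt f h]%SET| <= 2 * num_crossings D)%N.
Proof.
pose P : {set edge G * edge G} := [set p | mt p.1 p.2 & (enum_rank p.1 < enum_rank p.2)%N]%SET.
have hP : (#|P| <= num_crossings D)%N.
  have ex (p : edge G * edge G) : p \in P -> exists q : R * R,
      crossings (ecurve D) [set (p.1, q.1); (p.2, q.2)].
    rewrite inE => /andP[/andP[/eqP n /asboolP[x m]] _].
    by have [q [h _]] := meet_crossing n m; exists q.
  pose K (p : edge G * edge G) : set (edge G * R) := if pselect (p \in P) is left m
    then let q := projT1 (cid (ex p m)) in [set (p.1, q.1); (p.2, q.2)] else set0.
  rewrite cardE -(size_map K); apply: uniq_leq_size.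
    rewrite map_inj_in_uniq ?enum_uniq // => -[e f] [e' f']; rewrite !mem_enum => pP p'P.
    rewrite /K; case: pselect => // m; case: pselect => // m'.
    case: cid => q _ /=; case: cid => q' _ /= /pair_set_eq[h1 h2].
    move: pP p'P; rewrite !inE /= => /andP[_ r] /andP[_ r'].
    case: h1 => -[a _]; case: h2 => -[b _]; move: r r'; rewrite a b ?ltnn // => r r'.
    by move: (ltn_trans r r'); rewrite ltnn.
  move=> X /mapP[p]; rewrite mem_enum => pP ->.
  rewrite in_fset_set ?inE; last exact: crossings_finite.
  by rewrite /K; case: pselect => // m; case: cid.
apply: leq_trans (_ : 2 * #|P| <= _)%N; last by rewrite leq_mul2l hP orbT.
have e1 : (\sum_f #|[set h | mt f h & (enum_rank f < enum_rank h)%N]%SET| = #|P|)%N.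
  rewrite -[RHS]sum1_card (partition_big fst predT) //=; apply: eq_bigr => f _.
  rewrite -sum1_card (reindex_onto (fun h => (f, h)) snd) /=; last first.
    by move=> [a b] /= /andP[_ /eqP ->].
  by apply: eq_bigl => h; rewrite !inE /= !eqxx !andbT.
have e2 : (\sum_f #|[set h | mt f h & (enum_rank h < enum_rank f)%N]%SET| = #|P|)%N.
  rewrite card_set_exchange -e1; apply: eq_bigr => f _; apply: eq_card => h.
  by rewrite !inE mt_sym.
rewrite mul2n -addnn -{1}e1 -e2 -big_split; apply: leq_sum => f _ /=.
rewrite -(cardsID [set h | (enum_rank f < enum_rank h)%N]%SET); apply: leq_add.
  by apply: subset_leq_card; apply/fintype.subsetP => h; rewrite !inE.
apply: subset_leq_card; apply/fintype.subsetP => h; rewrite !inE -leqNgt => /andP[r m].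
rewrite m /= ltn_neqAle r andbT; apply: contraTneq m => /val_inj/enum_rank_inj ->.
by rewrite mt_irr.
Qed.

End CountCrossings.

Local Close Scope classical_set_scope.

(** * The theorem *)

Section Assembly.
Variables (R : realType) (G : multigraph) (D : drawing R G).
Hypothesis mono : monotone_drawing D.
Hypothesis nonhom : non_homotopic D.
Local Notation n := #|vertex G|.
Local Notation m := #|edge G|.
Local Notation X := (num_crossings D).
Local Notation lf := (lf D).
Local Notation rt := (rt D).
Local Notation ab := (ab D).

(** From [2m <= 6n + 2X] and [6n <= 3m/2]. *)
Lemma edges_le_crossings : (4 * n <= m)%N -> (m <= 4 * X)%N.
Proof.
move=> nm; have := planar_bound (lf_rt mono) (@rt_bound _ _ D)
  (separated_drawing mono nonhom) (@mt_irr _ _ D) (@mt_sym _ _ D) (alternation_mt mono).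
by have := sum_mt_le D; move: nm; clear; lia.
Qed.

Lemma crossings_power d B : local_bound lf rt ab d.+1 -> (0 < d)%N -> (160 <= B)%N ->
  (4 * n <= m)%N -> (m ^ (2 * d).+1 <= Kconst B d * n ^ d.+1 * X ^ d)%N.
Proof.
move=> hD d0 B160 nm.
apply: (crossing_count (layered_drawing mono) (@mt_sym _ _ D) (@rt_bound _ _ D)
  (separated_drawing mono nonhom) hD (ranked_drawing mono) (sum_mt_le D) d0 B160).
exact: edges_le_crossings.
Qed.

End Assembly.

(** * Extraction of roots *)

Section Roots.
Variable R : realType.

Definition root_const (B d : nat) : R := ((Kconst B d).+1%:R^-1) `^ (d%:R^-1).

Lemma root_const_gt0 B d : 0 < root_const B d.
Proof. by apply: powR_gt0; rewrite invr_gt0 ltr0n. Qed.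

Lemma powRXn (x a : R) (d : nat) : (x `^ a) ^+ d = x `^ (a * d%:R).
Proof. by rewrite -powR_mulrn ?powR_ge0 // powRrM. Qed.

Lemma power_to_root (B d m n X : nat) : (0 < d)%N ->
  (m ^ (2 * d).+1 <= Kconst B d * n ^ d.+1 * X ^ d)%N ->
  root_const B d * (m%:R `^ (2 + 1 / d%:R) / n%:R `^ (1 + 1 / d%:R)) <= X%:R.
Proof.
move=> d0 h; have dR : d%:R != 0 :> R by rewrite pnatr_eq0 -lt0n.
have ex (a : R) : (a + 1 / d%:R) * d%:R = a * d%:R + 1.
  by rewrite mulrDl mul1r mulVf.
(* For [n = 0] the denominator is 0 and its inverse is read as 0. *)
case: (posnP n) => [->|n0].
  rewrite mulr0n (@powR0 _ (1 + 1 / d%:R)) ?invr0 ?mulr0 ?ler0n //.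
set K := Kconst B d in h *.
rewrite -(@ler_pXn2r _ d) // ?nnegrE ?ler0n //; last first.
  by rewrite mulr_ge0 ?powR_ge0 // divr_ge0 ?powR_ge0.
rewrite !exprMn exprVn /root_const -/K !powRXn !ex mulVf // powRr1 ?invr_ge0 ?ler0n //.
have e1 : m%:R `^ (2 * d%:R + 1) = (m ^ (2 * d).+1)%:R :> R.
  by rewrite -natrM natr1 powR_mulrn ?ler0n // natrX.
have e2 : n%:R `^ (1 * d%:R + 1) = (n ^ d.+1)%:R :> R.
  by rewrite mul1r natr1 powR_mulrn ?ler0n // natrX.
rewrite e1 e2 mulrA ler_pdivrMr ?ltr0n ?expn_gt0 ?n0 // mulrC ler_pdivrMr ?ltr0n //.
rewrite -natrX -!natrM ler_nat; apply: leq_trans h _.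
by move: (n ^ d.+1)%N (X ^ d)%N (Kconst B d) @K => a b K0 K; rewrite /K; clear; nia.
Qed.

End Roots.

(* In (a) with k = 0 the exponent 1/k is read as 0^-1 = 0. A monotone drawing in
   which no two edges cross has no crossings at all, so for a graph with a vertex
   the bound then says that the hypotheses cannot hold, exactly as it would with
   1/0 read as infinity. *)
Theorem theorem3 (R : realType) (k : nat) :
  exists alpha beta gamma : R,
    [/\ 0 < alpha, 0 < beta, 0 < gamma &
    forall (G : multigraph) (D : drawing R G),
      let n := #|vertex G| in
      let m := #|edge G| in
      (4 * n <= m)%N -> monotone_drawing D -> non_homotopic D ->
      [/\ (forall e f : edge G, e <> f ->
             (num_crossings_between D e f <= k)%N) ->
          alpha * (m%:R `^ (2 + 1 / k%:R) / n%:R `^ (1 + 1 / k%:R))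
            <= (num_crossings D)%:R,
          (forall e f : edge G, e <> f -> incident e f ->
             (num_crossings_between D e f <= k)%N) ->
          beta * (m%:R `^ (2 + 1 / k.+1%:R) / n%:R `^ (1 + 1 / k.+1%:R))
            <= (num_crossings D)%:R
        & (forall e f : edge G, e <> f -> parallel e f ->
             (num_crossings_between D e f <= k)%N) ->
          gamma * (m%:R `^ (2 + 1 / k.+2%:R) / n%:R `^ (1 + 1 / k.+2%:R))
            <= (num_crossings D)%:R]].
Proof.
(* Hiding the value 160 keeps [2 ^ B] symbolic. *)
have [B B160] : exists B, (160 <= B)%N by exists 160%N.
exists (root_const R B k), (root_const R B k.+1), (root_const R B k.+2).
split; [exact: root_const_gt0|exact: root_const_gt0|exact: root_const_gt0|].
move=> G D n m nm mono nonhom.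
have lr := lf_rt mono.
have ac zs e f b j := @alternation_crossings R G D mono zs e f b j.
split=> hk.
- have hD : local_bound (lf D) (rt D) (ab D) k.+1.
    by apply: (local_bound_all lr ac) => e f /eqP; exact: hk.
  case: (posnP k) => [k0|k0]; last exact: power_to_root (crossings_power _ _ hD _ B160 nm).
  rewrite k0 in hD *.
  (* For [k = 0] the local exponent is 1, and [4n <= m <= 3n] leaves only [m = 0]. *)
  have h3 : (m <= 3 * n)%N.
    have := hD (iota 0 n) [set: edge G]%SET (iota_uniq _ _) _ (separated_drawing mono nonhom).
    rewrite cardsT size_iota expn1; apply=> e _.
    by rewrite !mem_iota /= !add0n rt_bound (ltn_trans (lr e) (rt_bound D e)).
  have m0 : m = 0%N by move: nm h3; rewrite -/n -/m; clear; lia.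
  by rewrite m0 powR0 ?mul0r ?mulr0 // invr0 mulr0 addr0.
- apply: power_to_root (crossings_power _ _ _ _ B160 nm) => //.
  apply: (local_bound_star lr ac) => e f /eqP nef el; apply: hk => //.
  have elv : lv D e = lv D f by exact: (@idx_inj _ _ D).
  exists (lv D e); have [-> _ _] := lvrvP D e; have [-> _ _] := lvrvP D f.
  by rewrite elv !inE eqxx.
- apply: power_to_root (crossings_power _ _ _ _ B160 nm) => //.
  apply: (local_bound_parallel lr ac) => e f /eqP nef el er; apply: hk => //.
  have elv : lv D e = lv D f by exact: (@idx_inj _ _ D).
  have erv : rv D e = rv D f by exact: (@idx_inj _ _ D).
  by rewrite /parallel; have [-> _ _] := lvrvP D e; have [-> _ _] := lvrvP D f; rewrite elv erv.
Qed.
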